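(* Let $I\subset K[x,y,z]$ be a monomial ideal and let $T = T_d(I)$ be a balanced triangular region. Suppose that all floating punctures of $T$ (and all minimal covering regions of overlapping punctures of $T$) with other punctures of $T$ in their shadows have even side length. Then any two lozenge tilings of $T$ have the same perfect matching sign and the same lattice path sign. Thus, $\operatorname{perm} Z(T) = |\det Z(T)|$. In particular, $Z(T)$ has maximal rank over a field of characteristic zero if and only if $T$ is tileable.
   Context: For $d\ge 1$, $\mathcal{T}_d$ is the equilateral triangle of side length $d$ subdivided into equilateral unit triangles. Its downward-pointing unit triangles are labelled bijectively by the monomials of degree $d-2$ in $x,y,z$, and its upward-pointing unit triangles by the monomials of degree $d-1$, with $x^{d-1}$ at the top, $y^{d-1}$ at the bottom-left, $z^{d-1}$ at the bottom-right; a downward-pointing triangle with label $n$ and an upward-pointing triangle with label $m$ share an edge iff $m\in\{xn,yn,zn\}$. $T=T_d(I)$ is the set of unit triangles whose label is not in $I$. Let $D$ (resp. $U$) be the set of monomials of degree $d-2$ (resp. $d-1$) not in $I$. $T$ is balanced if $|D|=|U|$. A lozenge tiling of $T$ is a partition of $T$ into lozenges (unions of two unit triangles sharing an edge), equivalently a bijection $\pi:D\to U$ with $\pi(n)\in\{xn,yn,zn\}$; $T$ is tileable if it is empty or has a lozenge tiling. Monomials of the same degree are ordered reverse-lexicographically ($x^ay^bz^c>x^py^qz^r$ if the last non-zero entry of $(a-p,b-q,c-r)$ is negative). $Z(T)$ is the zero-one matrix with rows indexed by $D$ and columns by $U$ in this order, with $(n,m)$ entry $1$ iff $m\in\{xn,yn,zn\}$;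 $\operatorname{perm}$ denotes the permanent, and the permanent and determinant of a $0\times 0$ matrix are $1$. The perfect matching sign of a tiling is the signature of the permutation given by $\pi$. The lattice path sign is defined as follows: let $A_1,\dots,A_m$ be the $u\in U$ with $z\nmid u$, and $E_1,\dots,E_m$ the monomials $u\in I$ of degree $d-1$ with $z\mid u$ and $u/z\notin I$, each listed from smallest to largest. For each $n\in D$ draw a step from $xn$ to $zn$ if $\pi(n)=xn$ and from $yn$ to $zn$ if $\pi(n)=yn$. The resulting path starting at $A_i$ ends at $E_{\lambda(i)}$ for a permutation $\lambda$, and the lattice path sign is $\operatorname{sgn}\lambda$. Punctures: let $J(T)$ be the largest ideal generated by monomials of degree at most $d-1$ with $T=T_d(J(T))$. The punctures of $T$ correspond to the minimal generators of $J(T)$: the puncture of $x^ay^bz^c$ is the upward-pointing triangle consisting of all unit triangles of $\mathcal{T}_d$ whose labels are divisible by $x^ay^bz^c$; its side length is $d-(a+b+c)$. Two punctures overlap if they share at least an edge (equivalently, the least common multiple of their monomials has degree at most $d-1$), and touch if they share precisely a vertex (the least common multiple has degree $d$). The minimal covering region of two overlapping punctures is the smallest upward-pointing triangle containing both, i.e. the one associated to the greatest common divisor of their monomials; its side length is $d$ minus the degree of that greatest common divisor. Recursively, a puncture is non-floating if it touches the boundary of $\mathcal{T}_d$ (i.e. $a=0$, $b=0$ or $c=0$) or if it overlaps or touches a non-floating puncture of $T$; otherwise it is floating. The shadow of a puncture (or minimal covering region) associated to $x^ay^bz^c$ is the area that is both below it and to the right of the line extending its upper-right edge, i.e. the set of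 unit triangles whose labels have $x$-exponent less than $a$ and $y$-exponent less than $b$; a puncture is in the shadow if some of its unit triangles lie there. *)

(* Defs.v *)
From mathcomp Require Import all_boot all_order all_fingroup all_algebra.
From mathcomp Require Import mpoly.

Set Implicit Arguments.
Unset Strict Implicit.
Unset Printing Implicit Defensive.

Import GRing.Theory Num.Theory.

Local Open Scope ring_scope.

Definition vx : 'I_3 := @Ordinal 3 0 isT.
Definition vy : 'I_3 := @Ordinal 3 1 isT.
Definition vz : 'I_3 := @Ordinal 3 2 isT.

Definition mgcd (m1 m2 : 'X_{1..3}) : 'X_{1..3} :=
  [multinom minn (m1 i) (m2 i) | i < 3].

(* The order [<=%O] that the library puts on ['X_{1..n}] is not the
   reverse-lexicographic one: it makes x * z larger than y ^ 2. *)
Definition revlex_lt (m n : 'X_{1..3}) : bool :=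
  [exists i : 'I_3,
     (n i < m i)%N && [forall j : 'I_3, (i < j)%N ==> (n j == m j)]].

Definition revlex_le (m n : 'X_{1..3}) : bool := (m == n) || revlex_lt m n.

(* The monomials of degree [d - k], from smallest to largest. The condition is
   an addition because the degree d - 2 is negative for d = 1. *)
Definition monomials (d k : nat) : seq 'X_{1..3} :=
  sort revlex_le
    [seq m <- [seq bmnm b | b : 'X_{1..3 < d}] | (mdeg m + k == d)%N].

Definition permanent (R : comNzRingType) (n : nat) (A : 'M[R]_n) : R :=
  \sum_(s : 'S_n) \prod_(i < n) A i (s i).

Section Ideals.

Variable K : fieldType.
Implicit Types (I J : {pred {mpoly K[3]}}) (G : 'X_{1..3} -> Prop).

Definition generated_by G I : Prop :=
  forall p : {mpoly K[3]}, p \in I <->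
    exists2 s : seq ({mpoly K[3]} * 'X_{1..3}),
      forall c, c \in s -> G c.2 & p = \sum_(c <- s) c.1 * 'X_[c.2].

Definition monomial_ideal I : Prop := exists G, generated_by G I.

Definition monomial_ideal_below (d : nat) I : Prop :=
  exists2 G, forall m, G m -> (mdeg m < d)%N & generated_by G I.

Definition min_generator J (m : 'X_{1..3}) : Prop :=
  'X_[m] \in J /\
  forall m' : 'X_{1..3}, (m' <= m)%MM -> 'X_[m'] \in J -> m' = m.

End Ideals.

Section Region.

Variables (K : fieldType) (I : {pred {mpoly K[3]}}) (d : nat).

Implicit Types (m n u v w : 'X_{1..3}) (pi : 'X_{1..3} -> 'X_{1..3}).

Definition down : seq 'X_{1..3} := [seq m <- monomials d 2 | 'X_[m] \notin I].
Definition up : seq 'X_{1..3} := [seq m <- monomials d 1 | 'X_[m] \notin I].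

Definition balanced : Prop := size down = size up.

Definition adjacent n m : bool := [exists i : 'I_3, m == (n + U_(i))%MM].

(* Only the values of [pi] on [down] matter. *)
Definition lozenge_tiling pi : Prop :=
  [/\ {in down, forall n, pi n \in up},
      {in down &, injective pi},
      {in up, forall m, exists2 n, n \in down & pi n = m}
    & {in down, forall n, adjacent n (pi n)}].

Definition tileable : Prop :=
  (down = [::] /\ up = [::]) \/ exists pi, lozenge_tiling pi.

Definition biadjacency (R : comNzRingType) : 'M[R]_(size down, size up) :=
  \matrix_(i, j) (adjacent (nth 0%MM down i) (nth 0%MM up j))%:R.

Definition sq_biadjacency (R : comNzRingType) (bal : balanced) :
    'M[R]_(size down) :=
  castmx (erefl (size down), esym bal) (biadjacency R).

Definition perfect_matching_sign pi (e : int) : Prop :=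
  exists2 sigma : 'S_(size down),
    forall i : 'I_(size down), nth 0%MM up (sigma i) = pi (nth 0%MM down i)
    & e = (-1) ^+ sigma.

Definition path_starts : seq 'X_{1..3} :=
  [seq u : 'X_{1..3} <- up | u vz == 0%N].

Definition path_ends : seq 'X_{1..3} :=
  [seq u <- monomials d 1 |
     [&& 'X_[u] \in I, (0 < u vz)%N & 'X_[u - U_(vz)] \notin I]].

Definition path_step pi : rel 'X_{1..3} := fun u v =>
  has (fun n => [&& u == pi n,
                    (pi n == n + U_(vx))%MM || (pi n == n + U_(vy))%MM
                  & v == (n + U_(vz))%MM]) down.

Definition path_ends_at pi u v : Prop :=
  (exists2 p : seq 'X_{1..3}, path (path_step pi) u p & last u p = v) /\
  forall w, ~~ path_step pi v w.

Definition lattice_path_sign pi (e : int) : Prop :=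
  size path_starts = size path_ends /\
  exists2 lambda : 'S_(size path_starts),
    forall i : 'I_(size path_starts),
      path_ends_at pi (nth 0%MM path_starts i) (nth 0%MM path_ends (lambda i))
    & e = (-1) ^+ lambda.

End Region.

Section Punctures.

Variables (K : fieldType) (I : {pred {mpoly K[3]}}) (d : nat).

Implicit Types (m q w : 'X_{1..3}) (J : {pred {mpoly K[3]}}).

Definition same_region J : Prop := down J d = down I d /\ up J d = up I d.

Definition puncture_ideal J : Prop :=
  [/\ monomial_ideal_below d J, same_region J
    & forall J', monomial_ideal_below d J' -> same_region J' ->
        {subset J' <= J}].

(* Punctures and covering regions are represented by the monomials whose
   multiples label their unit triangles. *)
Definition puncture m : Prop :=
  exists2 J, puncture_ideal J & min_generator J m.

Definition side_length m : nat := (d - mdeg m)%N.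

(* The triangles of [m1] and [m2] meet in that of their lcm, which has side
   length [d - mdeg (mlcm m1 m2)]. *)
Definition overlap m1 m2 : bool := (mdeg (mlcm m1 m2) < d)%N.
Definition touch m1 m2 : bool := (mdeg (mlcm m1 m2) == d)%N.

Inductive non_floating : 'X_{1..3} -> Prop :=
| non_floating_boundary m :
    puncture m -> (exists i : 'I_3, m i = 0%N) -> non_floating m
| non_floating_next m m' :
    puncture m -> non_floating m' -> overlap m m' || touch m m' ->
    non_floating m.

Definition floating m : Prop := puncture m /\ ~ non_floating m.

(* Some unit triangle of the puncture [q] lies in the shadow of [m]. *)
Definition in_shadow m q : Prop :=
  exists w, [/\ w \in monomials d 1 ++ monomials d 2, (q <= w)%MM,
                (w vx < m vx)%N & (w vy < m vy)%N].

End Punctures.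

(* Main.v *)
Require Import Defs.
From mathcomp Require Import all_boot all_order all_fingroup all_algebra.
From mathcomp Require Import mpoly zify.

Set Implicit Arguments.
Unset Strict Implicit.
Unset Printing Implicit Defensive.

Import GRing.Theory Num.Theory.

Local Open Scope ring_scope.

(** The perfect matching sign and the lattice path sign are computed as parities
    of inversion numbers. Both depend on a tiling only through the sum, over the
    end points [e] of the lattice paths, of the number of paths that pass [e] on
    one fixed side. For two tilings the difference of these numbers at [e] is the
    difference [hdiff] of their height functions. Both height functions are
    constant along the boundary of every puncture, so [hdiff] is constant on
    clusters of overlapping or touching punctures and vanishes on non-floating
    ones. If nothing lies in the shadow of a puncture, or of the covering region of
    two overlapping ones, then all lozenges in that shadow are forced, so that
    [hdiff] vanishes there as well. Hence wherever [hdiff] is non-zero all side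
    lengths and all overlaps are even, and a count of the exposed left sides of the
    punctures, slice by slice in the exponent of z, shows that [hdiff] sums to an
    even number over the end points. *)

Local Open Scope nat_scope.

(** * A union of even intervals *)

(** The hypotheses control single punctures and gcds of two punctures, whereas the exposed part of a
    puncture is what remains after removing several others, so a direct inclusion-exclusion would
    ask for the parity of multiple overlaps. Slicing at a fixed exponent of z turns punctures into
    intervals, and for intervals even pairwise intersections already force an even union.
    Intersections of two punctures correspond to lcms, whose parity follows from that of the gcd
    because the degrees of gcd and lcm add up to the two given degrees. The obstacle left is that
    two punctures starting at levels below [t] meet in the slice at [t] in length d - (max a + max b
    + t), which need not be the side length of their lcm. Both signs reduce to one sum because the
    numbers of lozenges of each kind per level of z are the same for all tilings. *)

Lemma even_count_union (s : seq (nat * nat)) (M : nat) :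
  {in s &, forall p q : nat * nat, ~~ odd (minn p.2 q.2 - maxn p.1 q.1)} ->
  {in s, forall p : nat * nat, p.2 <= M} ->
  ~~ odd (\sum_(0 <= x < M) has (fun p => p.1 <= x < p.2) s).
Proof.
elim/ltn_ind: M s => M IH s hs hM.
case: (boolP (has (fun p => (p.1 < M) && (p.2 == M)) s)) => [/hasP[p0 p0s /andP[p0l p0M]]|hN].
  (* [p] is a longest interval ending at [M]. It is even and entirely covered, so only the points
     before its start [l] remain to be counted. *)
  have [p [ps p2 p1M pmin]] : exists p : nat * nat, [/\ p \in s, p.2 = M, p.1 < M
      & forall q : nat * nat, q \in s -> q.2 = M -> p.1 <= q.1].
    have exQ : exists l : nat, has (fun q => (q.1 == l) && (q.2 == M)) s.
      by exists p0.1; apply/hasP; exists p0 => //; rewrite eqxx.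
    case: (ex_minnP exQ) => l /hasP[p ps /andP[/eqP p1 /eqP p2]] lmin.
    have pmin (q : nat * nat) : q \in s -> q.2 = M -> l <= q.1.
      by move=> qs q2; apply: lmin; apply/hasP; exists q; rewrite // q2 !eqxx.
    exists p; split; rewrite ?p1 // (leq_ltn_trans _ p0l) //.
    exact: pmin p0s (eqP p0M).
  have [l p1] : exists l : nat, p.1 = l by exists p.1.
  move: p1M pmin; rewrite p1 => lM pmin.
  rewrite (@big_cat_nat _ _ _ l) //=; last by lia.
  rewrite [X in _ + X](eq_big_nat _ _ (F2 := fun=> 1)); last first.
    move=> x hx; apply/eqP; rewrite eqb1; apply/hasP; exists p => //=; lia.
  rewrite sum_nat_const_nat muln1 oddD.
  have pe := hs _ _ ps ps.
  have -> : odd (M - l) = false by move: pe; rewrite minnn maxnn p1 p2; lia.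
  rewrite addbF.
  pose s' := [seq (q.1, minn q.2 l) | q <- s].
  have -> : \sum_(0 <= x < l) has (fun q => q.1 <= x < q.2) s
          = \sum_(0 <= x < l) has (fun q => q.1 <= x < q.2) s'.
    apply: eq_big_nat => x hx; rewrite has_map; congr nat_of_bool.
    apply: eq_has => q /=; lia.
  apply: IH => //; last by move=> _ /mapP[q _ ->] /=; lia.
  (* An interval straddling [l] ends before [M] by the choice of [p]. It meets [p] from [l] to
     [q.2], and removing this even piece from the even interval [q] leaves an even rest. *)
  have key (q : nat * nat) : q \in s -> q.1 < l -> l < q.2 -> ~~ odd (l - q.1).
    move=> qs q1 q2.
    have qM : q.2 < M.
      have := hM q qs; rewrite leq_eqVlt => /orP[/eqP qM|//].
      have := pmin q qs qM; lia.
    have := hs _ _ ps qs; have := hs _ _ qs qs; rewrite p1 p2; lia.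
  move=> _ _ /mapP[/= q qs ->] /mapP[/= r rs ->] /=.
  rewrite minnACA minnn; case: (leqP (minn q.2 r.2) l) => [_|]; first exact: hs.
  rewrite leq_min => /andP[lq lr].
  case: (leqP q.1 r.1) => _.
    by case: (ltnP r.1 l) => [/key -> //|]; rewrite -subn_eq0 => /eqP ->.
  by case: (ltnP q.1 l) => [/key -> //|]; rewrite -subn_eq0 => /eqP ->.
case: M IH hM hN => [|M] IH hM hN; first by rewrite big_geq.
rewrite big_nat_recr //= [X in (_ + X)]/=.
have hM' (p : nat * nat) : p \in s -> (p.1 < M.+1) && (p.2 == M.+1) = false.
  by move=> ps; apply: contraNF hN => hp; apply/hasP; exists p.
have -> : has (fun p => p.1 <= M < p.2) s = false.
  apply/hasP => -[/= p ps]; apply/negP.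
  have := hM p ps; have := hM' p ps; case: p {ps} => /= u v; lia.
rewrite addn0.
pose s' := [seq (q.1, minn q.2 M) | q <- s].
have -> : \sum_(0 <= x < M) has (fun q => q.1 <= x < q.2) s
        = \sum_(0 <= x < M) has (fun q => q.1 <= x < q.2) s'.
  apply: eq_big_nat => x hx; rewrite has_map; congr nat_of_bool.
  apply: eq_has => q /=; lia.
apply: IH => //; last by move=> _ /mapP[q _ ->] /=; lia.
have key (q : nat * nat) : q \in s -> q.2 <= M \/ M < q.1.+1.
  move=> qs; have := hM q qs; case: (leqP q.2 M) => h; first by left.
  right; have := hM' q qs; lia.
move=> _ _ /mapP[/= q qs ->] /mapP[/= r rs ->] /=.
have := hs _ _ qs rs; have := key q qs; have := key r rs; lia.
Qed.

(** * Height differences *)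

Lemma subz_sum3 (a b c a' b' c' : nat) : a + b + c = a' + b' + c' ->
  ((a%:Z - a'%:Z) + (b%:Z - b'%:Z) + (c%:Z - c'%:Z) = 0)%R.
Proof. lia. Qed.

Section Height.

Variables (d : nat) (B : nat -> nat -> nat -> bool).

Definition upclosed : Prop :=
  forall x y z x' y' z', x <= x' -> y <= y' -> z <= z' -> B x y z -> B x' y' z'.

(* [cx x y z] says that the upward triangle labelled by the monomial with these
   exponents is matched with the downward triangle whose label is that monomial
   divided by x; similarly for [cy] and [cz]. *)
Record matching_at (cx cy cz : nat -> nat -> nat -> bool) : Prop := MatchingAt {
  mat_up : forall x y z, x + y + z + 1 = d -> ~~ B x y z ->
    cx x y z + cy x y z + cz x y z = 1;
  mat_hole : forall x y z, x + y + z + 1 = d -> B x y z ->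
    cx x y z + cy x y z + cz x y z = 0;
  mat_down : forall x y z, x + y + z + 2 = d -> ~~ B x y z ->
    cx x.+1 y z + cy x y.+1 z + cz x y z.+1 = 1;
  mat_x0 : forall y z, cx 0 y z = false;
  mat_y0 : forall x z, cy x 0 z = false;
  mat_z0 : forall x y, cz x y 0 = false }.

Definition is_end (x y z : nat) : bool :=
  [&& x + y + z + 1 == d, B x y z, 0 < z & ~~ B x y z.-1].

Hypothesis Bup : upclosed.

(** Induction on [x + y]: [(x, y, z.+1)] is not a hole, since otherwise it would be a path end. Its
    other downward neighbours, if any, lie in the shadow too and are already matched in direction z,
    so only [cz] is left for it. *)
Lemma matching_shadow cx cy cz (a b : nat) : matching_at cx cy cz ->
  (forall x y z, x < a -> y < b -> ~~ is_end x y z) ->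
  forall x y z, x < a -> y < b -> x + y + z + 2 = d -> ~~ B x y z ->
  cz x y z.+1.
Proof.
move=> [cu ch cd cx0 cy0 cz0] hE x y z.
have [k le_k] := ubnP (x + y).
elim: k x y z le_k => // k IH x y z le_k xa yb hd nB.
have nB' : ~~ B x y z.+1.
  by have := hE x y z.+1 xa yb; rewrite /is_end nB /= andbT; lia.
have U := cu x y z.+1 ltac:(lia) nB'.
have hx : cx x y z.+1 = false.
  case: x {hE U} => [|x] in le_k xa hd nB nB' *; first by rewrite cx0.
  have nB2 : ~~ B x y z.+1 by apply: contra nB'; apply: Bup; lia.
  have := IH x y z.+1; have := cd x y z.+1; lia.
have hy : cy x y z.+1 = false.
  case: y {hE U hx} => [|y] in le_k yb hd nB nB' *; first by rewrite cy0.
  have nB2 : ~~ B x y z.+1 by apply: contra nB'; apply: Bup; lia.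
  have := IH x y z.+1; have := cd x y z.+1; lia.
by move: U; rewrite hx hy; case: (cz _ _ _).
Qed.

(* Working outwards from the corner where the two triangles meet, every lozenge
   in the notch between them is forced. *)
Lemma matching_notch cx cy cz (a1 b1 c1 a2 b2 c2 : nat) :
  matching_at cx cy cz ->
  a2 + b1 + maxn c1 c2 < d ->
  (forall x y z, a1 <= x -> b1 <= y -> c1 <= z -> x + y + z + 1 = d -> B x y z) ->
  (forall x y z, a2 <= x -> b2 <= y -> c2 <= z -> x + y + z + 1 = d -> B x y z) ->
  forall x y z, a1 <= x < a2 -> b2 <= y < b1 -> x + y + z + 2 = d ->
  ~~ B x y z -> cz x y z.+1.
Proof.
move=> [cu ch cd cx0 cy0 cz0] ov h1 h2 x y z.
have [k le_k] := ubnP ((a2 - x) + (b1 - y)).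
elim: k x y z le_k => // k IH x y z le_k xa yb hd nB.
have D := cd x y z hd nB.
have hx : cx x.+1 y z = false.
  have [Bx|nBx] := boolP (B x.+1 y z).
    by have := ch x.+1 y z ltac:(lia) Bx; lia.
  have xa2 : x.+1 < a2.
    rewrite ltn_neqAle andbC; case/andP: xa => _ -> /=.
    by apply: contra nBx => /eqP e; apply: h2; lia.
  have [z' ez] : exists z', z = z'.+1 by exists z.-1; lia.
  have nB2 : ~~ B x.+1 y z' by apply: contra nBx; apply: Bup; lia.
  have := IH x.+1 y z'; have := cu x.+1 y z; rewrite -ez; lia.
have hy : cy x y.+1 z = false.
  have [By|nBy] := boolP (B x y.+1 z).
    by have := ch x y.+1 z ltac:(lia) By; lia.
  have yb1 : y.+1 < b1.
    rewrite ltn_neqAle andbC; case/andP: yb => _ -> /=.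
    by apply: contra nBy => /eqP e; apply: h1; lia.
  have [z' ez] : exists z', z = z'.+1 by exists z.-1; lia.
  have nB2 : ~~ B x y.+1 z' by apply: contra nBy; apply: Bup; lia.
  have := IH x y.+1 z'; have := cu x y.+1 z; rewrite -ez; lia.
by move: D; rewrite hx hy; case: (cz _ _ _).
Qed.

Variables cx1 cy1 cz1 cx2 cy2 cz2 : nat -> nat -> nat -> bool.
Hypothesis M1 : matching_at cx1 cy1 cz1.
Hypothesis M2 : matching_at cx2 cy2 cz2.

Definition dflow (c c' : nat -> nat -> nat -> bool) (x y z : nat) : int :=
  ((c x y z)%:Z - (c' x y z)%:Z)%R.

(* The difference of the height functions of the two tilings at the lattice
   vertex labelled by the monomial of degree [d] with exponents [y] and [z]. *)
Definition hdiff (y z : nat) : int :=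
  (\sum_(0 <= j < y) dflow cz1 cz2 (d - 1 - z - j) j z)%R.

Lemma hdiff_y0 z : hdiff 0 z = 0%R.
Proof. by rewrite /hdiff big_geq. Qed.

Lemma hdiff_z0 y : hdiff y 0 = 0%R.
Proof.
rewrite /hdiff big1 // => j _; rewrite /dflow.
by rewrite (mat_z0 M1) (mat_z0 M2) subrr.
Qed.

Lemma hdiff_z x y z : x + y + z + 1 = d ->
  (hdiff y.+1 z - hdiff y z)%R = dflow cz1 cz2 x y z.
Proof.
move=> hd; rewrite /hdiff big_nat_recr //= [X in (X - _)%R]addrC addrK.
by congr dflow; lia.
Qed.

Lemma dflow_sum x y z : x + y + z + 1 = d ->
  (dflow cx1 cx2 x y z + dflow cy1 cy2 x y z + dflow cz1 cz2 x y z = 0)%R.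
Proof.
move=> hd; apply: subz_sum3; have [nB|nB] := boolP (B x y z).
  by rewrite (mat_hole M1 hd nB) (mat_hole M2 hd nB).
by rewrite (mat_up M1 hd nB) (mat_up M2 hd nB).
Qed.

Lemma mat_down_hole cx cy cz : matching_at cx cy cz ->
  forall x y z, x + y + z + 2 = d -> B x y z ->
  cx x.+1 y z + cy x y.+1 z + cz x y z.+1 = 0.
Proof.
move=> M x y z hd nB.
have h x' y' z' : x <= x' -> y <= y' -> z <= z' -> x' + y' + z' + 1 = d ->
    cx x' y' z' + cy x' y' z' + cz x' y' z' = 0.
  by move=> lx ly lz hd'; apply: mat_hole M _ _ _ hd' _; apply: Bup nB.
have /eqP := h x.+1 y z ltac:(lia) (leqnn _) (leqnn _) ltac:(lia).
rewrite !addn_eq0 => /andP[/andP[/eqP-> _] _].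
have /eqP := h x y.+1 z (leqnn _) ltac:(lia) (leqnn _) ltac:(lia).
rewrite !addn_eq0 => /andP[/andP[_ /eqP->] _].
have /eqP := h x y z.+1 (leqnn _) (leqnn _) ltac:(lia) ltac:(lia).
by rewrite !addn_eq0 => /andP[_ /eqP->].
Qed.

Lemma dflow_sum_down x y z : x + y + z + 2 = d ->
  (dflow cx1 cx2 x.+1 y z + dflow cy1 cy2 x y.+1 z
     + dflow cz1 cz2 x y z.+1 = 0)%R.
Proof.
move=> hd; apply: subz_sum3; have [nB|nB] := boolP (B x y z).
  by rewrite (mat_down_hole M1 hd nB) (mat_down_hole M2 hd nB).
by rewrite (mat_down M1 hd nB) (mat_down M2 hd nB).
Qed.

(** Path independence: [hdiff] is summed along a row of constant z, and the conservation laws at an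
    upward and at a downward triangle carry the relation between neighbouring rows from [y] to
    [y.+1]. *)
Lemma hdiff_y x y z : x + y + z + 1 = d ->
  (hdiff y z - hdiff y z.+1)%R = dflow cy1 cy2 x y z.
Proof.
elim: y x => [|y IH] x hd.
  by rewrite !hdiff_y0 /dflow (mat_y0 M1) (mat_y0 M2) !subrr.
have := hdiff_z (x := x.+1) (y := y) (z := z) ltac:(lia).
have := hdiff_z (x := x) (y := y) (z := z.+1) ltac:(lia).
have := dflow_sum_down (x := x) (y := y) (z := z) ltac:(lia).
have := dflow_sum (x := x.+1) (y := y) (z := z) ltac:(lia).
have := IH x.+1 ltac:(lia).
clear; lia.
Qed.

Lemma hdiff_x x y z : x + y + z + 1 = d ->
  (hdiff y z.+1 - hdiff y.+1 z)%R = dflow cx1 cx2 x y z.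
Proof.
move=> hd; move: (hdiff_y hd) (hdiff_z hd) (dflow_sum hd); clear; lia.
Qed.

Lemma hdiff_hole x y z : x + y + z + 1 = d -> B x y z ->
  hdiff y.+1 z = hdiff y z /\ hdiff y z.+1 = hdiff y z.
Proof.
move=> hd hB.
have h cx cy cz : matching_at cx cy cz ->
    [/\ cx x y z = false, cy x y z = false & cz x y z = false].
  move=> M; have /eqP := mat_hole M hd hB.
  by rewrite !addn_eq0 !eqb0 => /andP[/andP[/negbTE -> /negbTE ->] /negbTE ->].
have [_ y1 z1] := h _ _ _ M1; have [_ y2 z2] := h _ _ _ M2.
have := hdiff_z hd; rewrite /dflow z1 z2 subrr => /eqP; rewrite subr_eq0.
have := hdiff_y hd; rewrite /dflow y1 y2 subrr => /eqP; rewrite subr_eq0.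
by move=> /eqP -> /eqP ->.
Qed.

Lemma hdiff_puncture a b c : 
  (forall x y z, a <= x -> b <= y -> c <= z -> x + y + z + 1 = d -> B x y z) ->
  forall y z, b <= y -> c <= z -> a + y + z <= d -> hdiff y z = hdiff b c.
Proof.
move=> hP y z; have [k le_k] := ubnP (y + z).
elim: k y z le_k => // k IH y z le_k hy hz hd.
have [yb|yb] := ltnP b y.
  case: y => // y in le_k hy hd yb *.
  have hB : B (d - y.+1 - z) y z by apply: hP; lia.
  have [-> _] := hdiff_hole (x := d - y.+1 - z) (y := y) (z := z) ltac:(lia) hB.
  by apply: IH; lia.
have [zc|zc] := ltnP c z; last by congr hdiff; lia.
case: z => // z in le_k hz hd zc *.
have hB : B (d - y - z.+1) y z by apply: hP; lia.
have [_ ->] := hdiff_hole (x := d - y - z.+1) (y := y) (z := z) ltac:(lia) hB.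
by apply: IH; lia.
Qed.

Lemma hdiff_x0 y z : y + z = d -> hdiff y z = 0%R.
Proof.
elim: y z => [|y IH] z hd; first by rewrite hdiff_y0.
have := hdiff_x (x := 0) (y := y) (z := z) ltac:(lia).
rewrite /dflow (mat_x0 M1) (mat_x0 M2) subrr IH; last by lia.
by rewrite sub0r => /eqP; rewrite oppr_eq0 => /eqP.
Qed.

(** Walk along the line y = b from the side x = 0, where [hdiff] vanishes. A change would need a
    downward triangle of the shadow matched in direction y, which [matching_shadow] excludes. *)
Lemma hdiff_shadow a b : a + b <= d ->
  (forall x y z, x < a -> y < b -> ~~ is_end x y z) ->
  hdiff b (d - a - b) = 0%R.
Proof.
elim: a => [|a IH] ab hE; first by apply: hdiff_x0; lia.
have hE' x y z : x < a -> y < b -> ~~ is_end x y z by move=> xa; apply: hE; lia.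
rewrite -(IH ltac:(lia) hE').
have -> : d - a - b = (d - a.+1 - b).+1 by lia.
have hd : a + b + (d - a.+1 - b) + 1 = d by lia.
apply/eqP; rewrite -subr_eq0 (hdiff_y hd) /dflow.
suff h cx cy cz : matching_at cx cy cz -> cy a b (d - a.+1 - b) = false.
  by rewrite (h _ _ _ M1) (h _ _ _ M2).
move=> M {IH}; case: b => [|b] in ab hE hE' hd *; first by rewrite (mat_y0 M).
have hd' : a + b + (d - a.+1 - b.+1) + 2 = d by lia.
have [hB|hB] := boolP (B a b (d - a.+1 - b.+1)).
  have /eqP := mat_down_hole M hd' hB.
  by rewrite !addn_eq0 !eqb0 => /andP[/andP[_ /negbTE ->] _].
have := mat_down M hd' hB.
rewrite (matching_shadow M hE (ltnSn a) (ltnSn b) hd' hB).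
by rewrite addn1 => -[] /eqP; rewrite addn_eq0 !eqb0 => /andP[_ /negbTE ->].
Qed.

(** Walk along the side x = a1 of the covering region, from the first puncture to the corner y = b2.
    A lozenge crossing this side would match an upward triangle in direction x that [matching_notch]
    matches in direction z. *)
Lemma hdiff_cover_side a1 b1 c1 a2 b2 c2 :
  a1 <= a2 -> b2 <= b1 ->
  a2 + b1 + maxn c1 c2 < d ->
  (forall x y z, a1 <= x -> b1 <= y -> c1 <= z -> x + y + z + 1 = d -> B x y z) ->
  (forall x y z, a2 <= x -> b2 <= y -> c2 <= z -> x + y + z + 1 = d -> B x y z) ->
  forall y, b2 <= y <= b1 -> hdiff y (d - a1 - y) = hdiff b1 c1.
Proof.
move=> le_a le_b ov h1 h2 y hy.
have -> : y = b1 - (b1 - y) by lia.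
have : b1 - y <= b1 - b2 by lia.
elim: (b1 - y) => {hy y} [|k IH] hk.
  by rewrite subn0; apply: hdiff_puncture h1 _ _ _ _ _; lia.
rewrite -IH; last by lia.
have -> : b1 - k = (b1 - k.+1).+1 by lia.
set y := b1 - k.+1.
have -> : d - a1 - y = (d - a1 - y.+1).+1 by lia.
set z := d - a1 - y.+1.
have hd : a1 + y + z + 1 = d by lia.
apply/eqP; rewrite -subr_eq0 (hdiff_x hd) /dflow.
suff h cx cy cz : matching_at cx cy cz -> cx a1 y z = false.
  by rewrite (h _ _ _ M1) (h _ _ _ M2).
move=> M; have [hB|hB] := boolP (B a1 y z).
  have /eqP := mat_hole M hd hB.
  by rewrite !addn_eq0 !eqb0 => /andP[/andP[/negbTE -> _] _].
have lt_a : a1 < a2.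
  by rewrite ltnNge; apply: contra hB => le_a'; apply: h2; lia.
have [z' ez] : exists z', z = z'.+1 by exists z.-1; lia.
have hB' : ~~ B a1 y z' by apply: contra hB; apply: Bup; lia.
have := matching_notch M ov h1 h2 (x := a1) (y := y) (z := z')
  ltac:(lia) ltac:(lia) ltac:(lia) hB'.
rewrite -ez => cz1'; have := mat_up M hd hB; rewrite cz1'.
by rewrite addn1 => -[] /eqP; rewrite addn_eq0 !eqb0 => /andP[/negbTE ->].
Qed.

(** The corner of the covering region with the smallest exponents of x and y has value 0 by
    [hdiff_shadow]. It belongs to one of the punctures or is joined to one by [hdiff_cover_side],
    and the overlap gives both punctures the same value. *)
Lemma hdiff_cover a1 b1 c1 a2 b2 c2 :
  maxn a1 a2 + maxn b1 b2 + maxn c1 c2 < d ->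
  (forall x y z, a1 <= x -> b1 <= y -> c1 <= z -> x + y + z + 1 = d -> B x y z) ->
  (forall x y z, a2 <= x -> b2 <= y -> c2 <= z -> x + y + z + 1 = d -> B x y z) ->
  (forall x y z, x < minn a1 a2 -> y < minn b1 b2 -> ~~ is_end x y z) ->
  hdiff b1 c1 = 0%R.
Proof.
move=> ov h1 h2 hE.
have S0 := hdiff_shadow (a := minn a1 a2) (b := minn b1 b2) ltac:(lia) hE.
have e12 : hdiff b1 c1 = hdiff b2 c2.
  rewrite -(hdiff_puncture h1 (y := maxn b1 b2) (z := maxn c1 c2)); try lia.
  by apply: hdiff_puncture h2 _ _ _ _ _; lia.
have [la|la] := leqP a1 a2; have [lb|lb] := leqP b2 b1.
- rewrite -(hdiff_cover_side la lb _ h1 h2 (y := b2)); try lia.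
  by rewrite -S0; congr hdiff; lia.
- rewrite -(hdiff_puncture h1 (y := b1) (z := d - a1 - b1)); try lia.
  by rewrite -S0; congr hdiff; lia.
- rewrite e12 -(hdiff_puncture h2 (y := b2) (z := d - a2 - b2)); try lia.
  by rewrite -S0; congr hdiff; lia.
rewrite e12 -(hdiff_cover_side (ltnW la) (ltnW lb) _ h2 h1 (y := b1)); try lia.
by rewrite -S0; congr hdiff; lia.
Qed.

End Height.

(** * Parity of the number of path ends *)

Lemma triple_enum (d : nat) (R : nat -> nat -> nat -> bool) :
  exists s : seq (nat * nat * nat),
    forall a b c, ((a, b, c) \in s) = [&& a < d, b < d, c < d & R a b c].
Proof.
exists [seq q <- [seq (p, c) | p <- [seq (a, b) | a <- iota 0 d, b <- iota 0 d],
                              c <- iota 0 d] | R q.1.1 q.1.2 q.2] => a b c.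
rewrite mem_filter /= andbC.
suff -> : ((a, b, c) \in [seq (p, c0) | p <- [seq (a0, b0) | a0 <- iota 0 d,
    b0 <- iota 0 d], c0 <- iota 0 d]) = [&& a < d, b < d & c < d].
  by rewrite -!andbA.
apply/allpairsP/idP.
  move=> [[[a' b'] c'] [/= /allpairsP[[a'' b''] [/=]]]].
  by rewrite !mem_iota !add0n /= => ha hb [-> ->] hc [-> -> ->]; rewrite ha hb hc.
move=> /and3P[ha hb hc]; exists ((a, b), c); split => //=; last by rewrite mem_iota.
by apply/allpairsP; exists (a, b); rewrite !mem_iota.
Qed.

Lemma odd_subl k d : k <= d -> ~~ odd (d - k) = (odd k == odd d).
Proof. by move=> kd; rewrite oddB //; case: (odd k); case: (odd d). Qed.

Lemma sum_window (F G : nat -> bool) (l r d : nat) : r <= d ->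
  (forall x, x < d -> F x = (l <= x < r) && G x) ->
  \sum_(0 <= x < d) F x = \sum_(l <= x < r) G x.
Proof.
move=> rd FG.
have [rl|lr] := leqP r l.
  rewrite [RHS]big_geq // big_nat big1 // => x /FG ->.
  by rewrite (_ : _ && _ = false) //; clear -rl; lia.
rewrite (@big_cat_nat _ _ _ l) //=; last by rewrite (leq_trans (ltnW lr)).
rewrite (@big_cat_nat _ _ _ r l d) //=; last exact: ltnW.
rewrite [X in X + _]big_nat [X in X + _]big1 => [|x hx]; last first.
  by rewrite FG; [rewrite leqNgt; case/andP: hx => _ -> | clear -hx lr rd; lia].
rewrite [X in _ + (_ + X)]big_nat [X in _ + (_ + X)]big1 => [|x hx]; last first.
  rewrite FG; last by case/andP: hx.
  by rewrite ltnNge; case/andP: hx => -> _; rewrite andbF.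
rewrite add0n addn0; apply: eq_big_nat => x hx; rewrite FG ?hx //.
by clear -hx rd; lia.
Qed.

Section Parity.

Variables (d : nat) (B P : nat -> nat -> nat -> bool).
Hypothesis Bup : upclosed B.
Hypothesis P_lt : forall a b c, P a b c -> a + b + c < d.
Hypothesis P_hole : forall a b c x y z, P a b c ->
  a <= x -> b <= y -> c <= z -> (x + y + z + 1 == d) || (x + y + z + 2 == d) -> B x y z.
Hypothesis P_ex : forall a b c, a + b + c < d ->
  (forall x y z, a <= x -> b <= y -> c <= z ->
     (x + y + z + 1 == d) || (x + y + z + 2 == d) -> B x y z) ->
  exists a' b' c', [/\ P a' b' c', a' <= a, b' <= b & c' <= c].
Hypothesis P_anti : forall a b c a' b' c', P a b c -> P a' b' c' ->
  a <= a' -> b <= b' -> c <= c' -> [/\ a = a', b = b' & c = c'].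

Variable f : nat -> nat -> bool.
Hypothesis f_const : forall a b c y z, P a b c ->
  b <= y -> c <= z -> a + y + z <= d -> f y z = f b c.
Hypothesis f_even : forall a b c, P a b c -> f b c -> ~~ odd (d - (a + b + c)).
Hypothesis f_cover : forall a b c a' b' c', P a b c -> P a' b' c' ->
  (a, b, c) <> (a', b', c') -> maxn a a' + maxn b b' + maxn c c' < d ->
  f b c -> ~~ odd (d - (minn a a' + minn b b' + minn c c')).

(** * The exposed left side of a single puncture *)

Section Slice.

Variables (a b t : nat).
Hypotheses (Pn : P a b t) (fn : f b t).

(** Comparing the exponents of z and y suffices for an order, since by [P_anti] two punctures that
    agree in both coincide. *)
Definition older (a' b' c' : nat) : bool :=
  P a' b' c' && ((c' < t) || ((c' == t) && (b' < b))).

(* In these coordinates [y] stands for the upward triangle on the level [t] with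
   exponents [d - 1 - t - y], [y] and [t]. *)
Definition covered (y : nat) : Prop :=
  exists a' b' c', [/\ older a' b' c', a' + y + t < d & b' <= y].

Lemma older_neq a' b' c' : older a' b' c' -> (a, b, t) <> (a', b', c').
Proof. by move=> /andP[_ h] [_ e1 e2]; move: h; rewrite -e1 -e2 !ltnn andbF. Qed.

Lemma older_le a' b' c' : older a' b' c' -> c' <= t.
Proof. by move=> /andP[_]; lia. Qed.

Lemma older_notin a' b' c' : older a' b' c' -> ~~ ((a' <= a) && (b' <= b)).
Proof.
move=> h; apply/negP => /andP[ha hb]; have ht := older_le h.
have := older_neq h; case/andP: h => hP _.
by case: (P_anti hP Pn ha hb ht) => -> -> ->.
Qed.

Lemma f_overlap a' b' c' a'' b'' c'' : P a' b' c' -> P a'' b'' c'' ->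
  maxn a' a'' + maxn b' b'' + maxn c' c'' < d -> f b' c' = f b'' c''.
Proof.
move=> h h' ov; rewrite -(f_const (y := maxn b' b'') (z := maxn c' c'') h); try lia.
by apply: (f_const h'); lia.
Qed.

Lemma cover_parity a1 b1 c1 a2 b2 c2 : P a1 b1 c1 -> P a2 b2 c2 ->
  (a1, b1, c1) <> (a2, b2, c2) -> maxn a1 a2 + maxn b1 b2 + maxn c1 c2 < d ->
  f b1 c1 -> odd (minn a1 a2 + minn b1 b2 + minn c1 c2) = odd d.
Proof.
move=> P1 P2 ne ov f1; apply/eqP; rewrite -odd_subl.
  exact: f_cover P1 P2 ne ov f1.
by clear -ov; lia.
Qed.

Lemma side_parity a1 b1 c1 : P a1 b1 c1 -> f b1 c1 -> odd (a1 + b1 + c1) = odd d.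
Proof.
move=> P1 f1; apply/eqP; rewrite -odd_subl; first exact: f_even P1 f1.
by rewrite ltnW // P_lt.
Qed.

(** Minima and maxima add up to the two degrees, so the parities of both side lengths and of the
    covering region determine that of the lcm. *)
Lemma lcm_parity a1 b1 c1 a2 b2 c2 : P a1 b1 c1 -> P a2 b2 c2 ->
  (a1, b1, c1) <> (a2, b2, c2) -> maxn a1 a2 + maxn b1 b2 + maxn c1 c2 < d ->
  f b1 c1 -> odd (maxn a1 a2 + maxn b1 b2 + maxn c1 c2) = odd d.
Proof.
move=> P1 P2 ne ov f1; have f2 : f b2 c2 by rewrite -(f_overlap P1 P2).
have := side_parity P1 f1; have := side_parity P2 f2.
have := cover_parity P1 P2 ne ov f1; move=> <-.
have m x y : odd (maxn x y) = odd x (+) odd y (+) odd (minn x y).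
  by have [] := leqP x y; case: (odd x); case: (odd y).
rewrite !oddD !m.
case: (odd (minn a1 a2)); case: (odd (minn b1 b2)); case: (odd (minn c1 c2));
by case: (odd a1); case: (odd b1); case: (odd c1);
  case: (odd a2); case: (odd b2); case: (odd c2).
Qed.

(* If [c2 < c1 < t] for a puncture [(a2, b2, c2)] that meets the left side of
   [(a, b, t)] only in its interior, then the multiples of x^a y^b2 z^c1 are
   covered by the three triangles [(a, b, t)], [(a1, b1, c1)] and [(a2, b2, c2)], so
   that an older puncture contains
   [(a2, b2, c2)] at level [t], against its minimality. Otherwise the overlap at
   level [t] has the parity of an lcm. *)
Lemma older_pair a1 b1 c1 a2 b2 c2 : older a1 b1 c1 -> older a2 b2 c2 ->
  (forall a' b' c', older a' b' c' -> a' <= a1 -> b' <= b1 -> a' = a1 /\ b' = b1) ->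
  (forall a' b' c', older a' b' c' -> a' <= a2 -> b' <= b2 -> a' = a2 /\ b' = b2) ->
  (exists2 y, b <= y < d - t - a & ~ covered y) ->
  a1 < a2 -> b2 < b1 ->
  ~~ odd (d - t - maxn a (maxn a1 a2) - maxn b (maxn b1 b2)).
Proof.
move=> o1 o2 m1 m2 [y0 hy0 nc] ha hb.
rewrite (maxn_idPr (ltnW ha)) (maxn_idPl (ltnW hb)).
have [ov|] := ltnP (maxn a a2 + maxn b b1 + t) d; last first.
  by move=> ov; rewrite (_ : _ - _ = 0) //; clear -ov; lia.
have -> : d - t - maxn a a2 - maxn b b1 = d - (maxn a a2 + maxn b b1 + t).
  by clear; lia.
rewrite odd_subl ?(ltnW ov) //; apply/eqP.
have [P1 P2] : P a1 b1 c1 /\ P a2 b2 c2 by case/andP: o1; case/andP: o2.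
have ct1 := older_le o1; have ct2 := older_le o2.
have mt c : c <= t -> maxn t c = t by move/maxn_idPl.
have ovn1 : maxn a a1 + maxn b b1 + maxn t c1 < d.
  by rewrite mt //; clear -ov ha; lia.
have ovn2 : maxn a a2 + maxn b b2 + maxn t c2 < d.
  by rewrite mt //; clear -ov hb; lia.
have ov12 : maxn a1 a2 + maxn b1 b2 + maxn c1 c2 < d.
  by clear -ov ha hb ct1 ct2; lia.
have f1 : f b1 c1 by rewrite -(f_overlap Pn P1).
have n1 := older_notin o1; have n2 := older_notin o2.
have [h2|h2] := leqP a2 a.
  have h1 : a1 <= a by clear -ha h2; lia.
  have := lcm_parity Pn P1 (older_neq o1) ovn1 fn.
  by rewrite (mt _ ct1) (maxn_idPl h1).
have [h1|h1] := leqP b1 b.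
  have h3 : b2 <= b by clear -hb h1; lia.
  have := lcm_parity Pn P2 (older_neq o2) ovn2 fn.
  by rewrite (mt _ ct2) (maxn_idPl h3) (maxn_idPr (ltnW h2)).
rewrite (maxn_idPr (ltnW h1)) (maxn_idPr (ltnW h2)) in ov.
have ne12 : (a1, b1, c1) <> (a2, b2, c2) by case=> e _ _; rewrite e ltnn in ha.
have := lcm_parity P1 P2 ne12 ov12 f1.
rewrite (maxn_idPr (ltnW ha)) (maxn_idPl (ltnW hb)).
(* Here the gcd with [(a, b, t)] is [(a, b, c')], so the even covering region compared with the even
   side length gives [c'] and [t] the same parity. *)
have big a' b' c' : a <= a' -> b <= b' -> c' <= t -> (a, b, t) <> (a', b', c') ->
    P a' b' c' -> maxn a a' + maxn b b' + maxn t c' < d -> odd c' = odd t.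
  move=> ha' hb' hc' ne P' ov'; have := cover_parity Pn P' ne ov' fn.
  rewrite (minn_idPl ha') (minn_idPl hb') (minn_idPr hc') -(side_parity Pn fn) !oddD.
  by case: (odd a); case: (odd b); case: (odd c'); case: (odd t).
have [k1|k1] := leqP a1 a; have [k2|k2] := leqP b2 b.
(* The two intervals overlap and together fill the slice of [(a, b, t)], against the uncovered
   [y0]. *)
- case: nc; case/andP: hy0 => yb yda.
  have [hyb|hyb] := leqP b1 y0.
    by exists a1, b1, c1; split => //; clear -yda k1; lia.
  by exists a2, b2, c2; split => //; clear -yb k2 hyb ov; lia.
- have tc2 := big _ _ _ (ltnW h2) (ltnW k2) ct2 (older_neq o2) P2 ovn2.
  have [tc1|tc1] := leqP c1 c2; first by rewrite !(oddD, tc2).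
  have [tc1'|tc1'] := leqP t c1.
    by rewrite (_ : c1 = t) //; apply/eqP; rewrite eqn_leq ct1.
  have [||a4 [b4 [c4 [P4 a4a b4b c4c]]]] := @P_ex a b2 c1.
  + by clear - tc1' ov h2 hb; lia.
  + move=> x y z hx hy hz hd.
    have [zt|zt] := leqP t z.
      exact: P_hole Pn hx (leq_trans (ltnW k2) hy) zt hd.
    have [yb|yb] := leqP b1 y; first exact: P_hole P1 (leq_trans k1 hx) yb hz hd.
    have [xa|xa] := leqP a2 x; first exact: P_hole P2 xa hy (leq_trans (ltnW tc1) hz) hd.
    by clear - hd zt yb xa ov; lia.
  have o4 : older a4 b4 c4 by rewrite /older P4 (leq_ltn_trans c4c tc1').
  have lt4 := leq_ltn_trans a4a h2.
  by case: (m2 _ _ _ o4 (ltnW lt4) b4b) => e; rewrite e ltnn in lt4.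
- have tc1 := big _ _ _ (ltnW k1) (ltnW h1) ct1 (older_neq o1) P1 ovn1.
  have [tc2|tc2] := leqP c2 c1; first by rewrite !(oddD, tc1).
  have [tc2'|tc2'] := leqP t c2.
    by rewrite (_ : c2 = t) //; apply/eqP; rewrite eqn_leq ct2.
  have [||a4 [b4 [c4 [P4 a4a b4b c4c]]]] := @P_ex a1 b c2.
  + by clear - tc2' ov h1 ha; lia.
  + move=> x y z hx hy hz hd.
    have [zt|zt] := leqP t z.
      exact: P_hole Pn (leq_trans (ltnW k1) hx) hy zt hd.
    have [xa|xa] := leqP a2 x; first exact: P_hole P2 xa (leq_trans k2 hy) hz hd.
    have [yb|yb] := leqP b1 y; first exact: P_hole P1 hx yb (leq_trans (ltnW tc2) hz) hd.
    by clear - hd zt yb xa ov; lia.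
  have o4 : older a4 b4 c4 by rewrite /older P4 (leq_ltn_trans c4c tc2').
  have lt4 := leq_ltn_trans b4b h1.
  by case: (m1 _ _ _ o4 a4a (ltnW lt4)) => _ e; rewrite e ltnn in lt4.
have tc1 := big _ _ _ (ltnW k1) (ltnW h1) ct1 (older_neq o1) P1 ovn1.
have tc2 := big _ _ _ (ltnW h2) (ltnW k2) ct2 (older_neq o2) P2 ovn2.
by have [_|_] := leqP c1 c2; rewrite !(oddD, tc1, tc2).
Qed.

(** The slice has even length, so covered and uncovered points have equal parity. The covered ones
    form a union of intervals given by older punctures. Keeping only those with minimal [(a', b')]
    leaves the union unchanged and supplies the minimality that [older_pair] needs. *)
Lemma uncovered_even (cov : nat -> bool) : (forall y, reflect (covered y) (cov y)) ->
  ~~ odd (\sum_(b <= y < d - t - a) ~~ cov y).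
Proof.
move=> covP; set M := d - t - a.
have ltn := P_lt Pn.
have bM : b < M by rewrite /M; clear -ltn; lia.
have [/hasP[y0]|/hasPn nhas] := boolP (has (fun y => ~~ cov y) (index_iota b M)); last first.
  rewrite big_seq big1 // => y /nhas; by case: (cov y).
rewrite mem_index_iota => hy0 /covP nc.
have sumE : \sum_(b <= y < M) cov y + \sum_(b <= y < M) ~~ cov y = M - b.
  rewrite -big_split /= (eq_bigr (fun=> 1)); last by move=> y _; case: (cov y).
  by rewrite sum_nat_const_nat muln1.
have Mb : ~~ odd (M - b).
  rewrite (_ : M - b = d - (a + b + t)); first exact: f_even.
  by rewrite /M; clear; lia.
suff : ~~ odd (\sum_(b <= y < M) cov y) by move: Mb; rewrite -sumE oddD; case: (odd _).
have [s0 s0P] := triple_enum d older.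
have s0P' q1 q2 q3 : (q1, q2, q3) \in s0 = older q1 q2 q3.
  rewrite s0P; case: (boolP (older q1 q2 q3)) => [o|]; last by rewrite !andbF.
  by have := P_lt (proj1 (andP o)); clear; lia.
pose minimal (q : nat * nat * nat) := all (fun q' : nat * nat * nat =>
  (q'.1.1 <= q.1.1) && (q'.1.2 <= q.1.2) ==> (q'.1 == q.1)) s0.
(* The interval of [q] at level [t], cut to that of [(a, b, t)]; it is empty if its bounds are out
   of order. *)
pose clip (q : nat * nat * nat) := (maxn b q.1.2, d - t - maxn a q.1.1).
pose s := [seq clip q | q <- s0 & minimal q].
have minP q1 q2 q3 : minimal (q1, q2, q3) -> forall a' b' c', older a' b' c' ->
    a' <= q1 -> b' <= q2 -> a' = q1 /\ b' = q2.
  move=> /allP h a' b' c'; rewrite -s0P' => /h /= h' ha hb.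
  by move: h'; rewrite ha hb => /eqP[-> ->].
have ex_min k : forall q1 q2 q3, q1 + q2 < k -> older q1 q2 q3 ->
    exists a' b' c', [/\ older a' b' c', minimal (a', b', c'), a' <= q1 & b' <= q2].
  elim: k => // k IH q1 q2 q3 lek o.
  have [m|] := boolP (minimal (q1, q2, q3)); first by exists q1, q2, q3.
  move=> /allPn[[[r1 r2] r3]]; rewrite s0P' negb_imply /= => o' /andP[/andP[h1 h2]] ne.
  have ne' : ~ (r1 = q1 /\ r2 = q2) by case=> e1 e2; rewrite e1 e2 eqxx in ne.
  have [|a' [b' [c' [o4 m4 l1 l2]]]] := IH r1 r2 r3 _ o'.
    by clear -lek h1 h2 ne'; lia.
  by exists a', b', c'; split; rewrite // ?(leq_trans l1) ?(leq_trans l2).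
have <- : \sum_(0 <= y < M) has (fun p : nat * nat => p.1 <= y < p.2) s
        = \sum_(b <= y < M) cov y.
  apply: sum_window => // y yM.
  apply/hasP/andP => [[p /mapP[[[q1 q2] q3]]]|[/andP[yb _] /covP]].
    rewrite mem_filter s0P' => /andP[_ o] -> /= /andP[h1 h2].
    rewrite yM andbT; split; first by clear -h1; lia.
    by apply/covP; exists q1, q2, q3; split => //; clear -h1 h2; lia.
  move=> [q1 [q2 [q3 [o h1 h2]]]].
  have [a' [b' [c' [o' m l1 l2]]]] := ex_min _ _ _ _ (ltnSn _) o.
  exists (clip (a', b', c')) => /=.
    by apply: map_f; rewrite mem_filter m s0P'.
  by move: yM; rewrite /M; clear -yb h1 h2 l1 l2; lia.
apply: even_count_union => [|p /mapP[q _ ->] /=]; last by rewrite /M; clear; lia.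
move=> _ _ /mapP[[[a1 b1] c1] h1 ->] /mapP[[[a2 b2] c2] h2 ->] /=.
move: h1 h2; rewrite !mem_filter !s0P' => /andP[m1 o1] /andP[m2 o2].
have -> : minn (d - t - maxn a a1) (d - t - maxn a a2) - maxn (maxn b b1) (maxn b b2)
    = d - t - maxn a (maxn a1 a2) - maxn b (maxn b1 b2).
  have minB u v w : minn (u - v) (u - w) = u - maxn v w by clear; lia.
  by rewrite minB (maxnACA a) (maxnACA b) !maxnn.
have unc : exists2 y, b <= y < d - t - a & ~ covered y by exists y0.
have [la|la|ea] := ltngtP a1 a2.
- have lb : b2 < b1.
    rewrite ltnNge; apply/negP => lb.
    by have [e _] := minP _ _ _ m2 _ _ _ o1 (ltnW la) lb; rewrite e ltnn in la.
  have := older_pair o1 o2 (minP _ _ _ m1) (minP _ _ _ m2) unc la lb.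
  by rewrite (maxn_idPr (ltnW la)).
- have lb : b1 < b2.
    rewrite ltnNge; apply/negP => lb.
    by have [e _] := minP _ _ _ m1 _ _ _ o2 (ltnW la) lb; rewrite e ltnn in la.
  have := older_pair o2 o1 (minP _ _ _ m2) (minP _ _ _ m1) unc la lb.
  by rewrite (maxn_idPr (ltnW la)) (maxnC b1).
(* With equal first exponents, minimality makes the second ones equal, and only an lcm with
   [(a, b, t)] remains. *)
have eb : b1 = b2.
  by case: (leqP b1 b2) => lb; [have [] := minP _ _ _ m2 _ _ _ o1 _ lb
    | have [] := minP _ _ _ m1 _ _ _ o2 _ (ltnW lb)]; rewrite ?ea.
rewrite -?ea -eb ?maxnn.
have [ov|ov] := ltnP (maxn a a1 + maxn b b1 + t) d; last first.
  by rewrite (_ : _ - _ = 0) //; clear -ov; lia.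
have -> : d - t - maxn a a1 - maxn b b1 = d - (maxn a a1 + maxn b b1 + t).
  by clear; lia.
rewrite odd_subl ?(ltnW ov) //; apply/eqP.
have tc := maxn_idPl (older_le o1).
have := lcm_parity Pn (proj1 (andP o1)) (older_neq o1); rewrite tc; exact.
Qed.

End Slice.
(* Each end is counted at the first puncture that contains it, in the order
   given by the exponents of z and then of y. *)
Lemma ends_even :
  ~~ odd (\sum_(t < d) \sum_(y < d) (is_end d B (d - 1 - t - y) y t && f y t)).
Proof.
have even_sum (F : 'I_d -> nat) : (forall i, ~~ odd (F i)) -> ~~ odd (\sum_(i < d) F i).
  move=> hF; apply: (big_ind (fun n => ~~ odd n)) => // m n.
  by rewrite oddD; case: (odd m); case: (odd n).
apply: (even_sum) => -[t td] /=.
case: t td => [|t'] td.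
  by rewrite big1 // => y _; rewrite /is_end /= !andbF.
move: t'.+1 (ltn0Sn t') td => {t'} t t0 td.
have [sP sPP] := triple_enum d P.
have sP' q1 q2 q3 : (q1, q2, q3) \in sP = P q1 q2 q3.
  rewrite sPP; case: (boolP (P q1 q2 q3)) => [o|]; last by rewrite !andbF.
  by have := P_lt o; clear; lia.
pose cover b y := has (fun q : nat * nat * nat =>
  [&& q.2 == t, q.1.2 == b, q.1.1 + y + t < d & b <= y]) sP.
have coverP b y : reflect (exists a, [/\ P a b t, a + y + t < d & b <= y]) (cover b y).
  apply: (iffP hasP) => [[[[q1 q2] q3]]|[a [hP h1 h2]]].
    by rewrite sP' /= => hP /and4P[/eqP e1 /eqP e2 h1 h2]; exists q1; rewrite e1 e2 in hP.
  by exists (a, b, t); rewrite ?sP' //= !eqxx h1 h2.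
pose first b y := cover b y && ~~ has (fun b' => cover b' y) (iota 0 b).
have endE y : y < d -> (is_end d B (d - 1 - t - y) y t && f y t : nat)
    = \sum_(b < d) ([&& is_end d B (d - 1 - t - y) y t, f y t & first b y] : nat).
  move=> yd; case: (boolP (is_end _ _ _ _ _)) => [hE|_]; last by rewrite big1.
  case: (f y t) => /=; last by rewrite big1.
  have exb : exists b, cover b y.
    have /and4P[/eqP hd hB _ nB] := hE.
    have [||a [b [c [hP ha hb hc]]]] := @P_ex (d - 1 - t - y) y t; first by clear -hd; lia.
      by move=> x' y' z' hx hy hz _; apply: Bup hB.
    (* With [c < t] the downward neighbour at level [t.-1] would be a hole as well, and the triangle
       would not be an end. *)
    have ct : c = t.
      apply/eqP; rewrite eqn_leq hc /= leqNgt; apply: contra nB => ct.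
      apply: (P_hole hP) => //; by clear -hd ct t0; lia.
    by exists b; apply/coverP; exists a; rewrite -{1}ct; split => //; clear -hd ha; lia.
  case: (ex_minnP exb) => b0 hb0 minb0.
  have b0d : b0 < d by have /coverP[a [/P_lt h _ _]] := hb0; clear -h; lia.
  rewrite (bigD1 (Ordinal b0d)) //= big1 ?addn0.
    rewrite /first hb0 /=; case: hasP => // -[b' ]; rewrite mem_iota => hb' /minb0.
    by clear -hb'; lia.
  move=> [b bd] ne; apply/eqP; rewrite eqb0 /=; apply: contra ne => /andP[cb /hasPn nb].
  have := minb0 _ cb; rewrite leq_eqVlt => /orP[/eqP e|lt]; first by apply/eqP/val_inj.
  by have := nb b0; rewrite mem_iota lt hb0 => /(_ isT).
rewrite (eq_bigr (fun y : 'I_d => \sum_(b < d) ([&& is_end d B (d - 1 - t - y) y t,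
    f y t & first b y] : nat))); last by move=> y _; apply: endE.
rewrite exchange_big /=; apply: (even_sum) => -[b bd] /=.
(* By [P_anti] at most one puncture has the exponents [b] and [t]. When [f b t] holds, the ends
   attributed to it are the uncovered points of its slice. *)
have [/hasP[[[a b'] c]]|/hasPn noP] :=
    boolP (has (fun q : nat * nat * nat => (q.1.2 == b) && (q.2 == t)) sP); last first.
  rewrite big1 // => y _; rewrite (_ : first b y = false) ?andbF //.
  apply/negP => /andP[/coverP[a [hP _ _]]] _.
  by have := noP (a, b, t); rewrite sP' hP /= !eqxx => /(_ isT).
rewrite sP' /= => Pn' /andP[/eqP eb /eqP ec].
have {a b' c Pn' eb ec} [a Pn] : exists a : nat, P a b t by exists a; rewrite -eb -ec.
have [fn|nfn] := boolP (f b t); last first.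
  rewrite big1 // => y _; apply/eqP; rewrite eqb0; apply/negP => /and3P[_ fy].
  move=> /andP[/coverP[a' [hP h1 h2]] _]; case/negP: nfn.
  by rewrite -(f_const hP h2 (leqnn t)) // ltnW.
have [s0 s0P] := triple_enum d (older b t).
pose cov y := has (fun q : nat * nat * nat => (q.1.1 + y + t < d) && (q.1.2 <= y)) s0.
have covP y : reflect (covered b t y) (cov y).
  apply: (iffP hasP) => [[[[q1 q2] q3]]|[q1 [q2 [q3 [o h1 h2]]]]].
    by rewrite s0P /= => /and4P[_ _ _ o] /andP[h1 h2]; exists q1, q2, q3; split.
  exists (q1, q2, q3) => /=; last by rewrite h1 h2.
  by rewrite s0P o; have := P_lt (proj1 (andP o)); clear; lia.
rewrite -(big_mkord predT (fun y => [&& is_end d B (d - 1 - t - y) y t, f y t & first b y] : nat)).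
rewrite (sum_window (l := b) (r := d - t - a) (G := fun y => ~~ cov y)).
- exact: (uncovered_even Pn fn covP).
- by clear; lia.
move=> y yd; apply/and3P/andP => [[hE fy /andP[/coverP[a' [hP h1 h2]] /hasPn nb]]|].
  have ea : a' = a.
    by case: (leqP a a') => la; [have [] := P_anti Pn hP la | have [] := P_anti hP Pn (ltnW la)].
  split; first by rewrite h2 -ea; clear -h1; lia.
  apply/covP => -[q1 [q2 [q3 [/andP[hq /orP[q3t|/andP[/eqP q3t q2b]]] h3 h4]]]].
    have /and4P[_ _ _ /negP[]] := hE.
    by apply: (P_hole hq) => //; clear -h3 q3t t0; lia.
  have := nb q2; rewrite mem_iota q2b => /(_ isT) /negP; apply; apply/coverP.
  by exists q1; rewrite -q3t; split => //; rewrite q3t.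
move=> [/andP[yb yda] /covP nc].
have h1 : a + y + t < d by clear -yda; lia.
split.
- apply/and4P; split => //.
  + by clear -h1; apply/eqP; lia.
  + by apply: (P_hole Pn) => //; clear -h1; lia.
  (* If the downward neighbour were a hole, a puncture of level at most [t.-1] would contain it and
     hence cover [y]. *)
  + apply/negP => hB; apply: nc.
    have [||q1 [q2 [q3 [hP ha hb hc]]]] := @P_ex (d - 1 - t - y) y t.-1.
    * by clear -h1 t0; lia.
    * by move=> x' y' z' hx hy hz _; apply: Bup hB.
    exists q1, q2, q3; split => //; last by clear -ha h1; lia.
    by rewrite /older hP; clear -hc t0; lia.
- by rewrite (f_const Pn yb (leqnn t)) // ltnW.
apply/andP; split; first by apply/coverP; exists a.
apply/hasPn => b'; rewrite mem_iota add0n /= => b'b; apply/negP => /coverP[a' [hP h2 h3]].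
by apply: nc; exists a', b', t; split => //; rewrite /older hP eqxx b'b orbT.
Qed.

End Parity.

(** * Monomials and inversions *)

Definition mon (x y z : nat) : 'X_{1..3} := [multinom nth 0 [:: x; y; z] i | i < 3].

Lemma mon_x x y z : mon x y z vx = x. Proof. by rewrite mnmE. Qed.
Lemma mon_y x y z : mon x y z vy = y. Proof. by rewrite mnmE. Qed.
Lemma mon_z x y z : mon x y z vz = z. Proof. by rewrite mnmE. Qed.
Definition monE := (mon_x, mon_y, mon_z).

Lemma ord3_cases (Q : 'I_3 -> Prop) : Q vx -> Q vy -> Q vz -> forall i, Q i.
Proof.
move=> hx hy hz [[|[|[|//]]] hi].
- by rewrite (_ : Ordinal _ = vx) //; apply: val_inj.
- by rewrite (_ : Ordinal _ = vy) //; apply: val_inj.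
by rewrite (_ : Ordinal _ = vz) //; apply: val_inj.
Qed.

Lemma mnm3P (m n : 'X_{1..3}) : m vx = n vx -> m vy = n vy -> m vz = n vz -> m = n.
Proof. by move=> hx hy hz; apply/mnmP; apply: ord3_cases. Qed.

Lemma monK (m : 'X_{1..3}) : mon (m vx) (m vy) (m vz) = m.
Proof. by apply: mnm3P; rewrite monE. Qed.

Lemma mdeg3 (m : 'X_{1..3}) : mdeg m = m vx + m vy + m vz.
Proof.
rewrite mdegE !big_ord_recl big_ord0 addn0 addnA.
by congr (_ + _ + _); congr (m _); apply: val_inj.
Qed.

Lemma mnm_le3 (m n : 'X_{1..3}) :
  (m <= n)%MM = [&& m vx <= n vx, m vy <= n vy & m vz <= n vz].
Proof.
apply/mnm_lepP/and3P => [h|[hx hy hz]]; first by split.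
exact: ord3_cases.
Qed.

Lemma mnmDU (m : 'X_{1..3}) (i j : 'I_3) : (m + U_(i))%MM j = m j + (i == j).
Proof. by rewrite mnmDE mnm1E. Qed.

Lemma mnmBU (m : 'X_{1..3}) (i j : 'I_3) : (m - U_(i))%MM j = m j - (i == j).
Proof. by rewrite mnmBE mnm1E. Qed.

Lemma adjacentP (n m : 'X_{1..3}) : reflect
  [\/ m = (n + U_(vx))%MM, m = (n + U_(vy))%MM | m = (n + U_(vz))%MM]
  (adjacent n m).
Proof.
apply: (iffP existsP) => [[i /eqP ->]|].
  by move: i; apply: ord3_cases; [constructor 1|constructor 2|constructor 3].
by case=> ->; [exists vx|exists vy|exists vz].
Qed.

Lemma revlex_lt3 (m n : 'X_{1..3}) : revlex_lt m n =
  (n vz < m vz) || (n vz == m vz) && ((n vy < m vy) || (n vy == m vy) && (n vx < m vx)).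
Proof.
apply/existsP/idP.
  case; apply: ord3_cases => /andP[hi /forallP h].
  - by have := h vy; have := h vz; rewrite /= => -> ->; rewrite hi !orbT.
  - by have := h vz; rewrite /= => ->; rewrite hi !orbT.
  by rewrite hi.
case/orP=> [h|/andP[ez /orP[h|/andP[ey h]]]].
- by exists vz; rewrite h; apply/forallP; apply: ord3_cases; rewrite //= ltnn.
- by exists vy; rewrite h; apply/forallP; apply: ord3_cases; rewrite //= ltnn.
by exists vx; rewrite h; apply/forallP; apply: ord3_cases; rewrite //= ltnn.
Qed.

Lemma revlex_ltE (m n : 'X_{1..3}) : mdeg m = mdeg n ->
  revlex_lt m n = (n vz < m vz) || (n vz == m vz) && (n vy < m vy).
Proof. by rewrite !mdeg3 revlex_lt3; clear; lia. Qed.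

Lemma revlex_lt_irr : irreflexive revlex_lt.
Proof. by move=> m; rewrite revlex_lt3 !ltnn !andbF. Qed.

Lemma revlex_lt_trans : transitive revlex_lt.
Proof. by move=> n m p; rewrite !revlex_lt3; clear; lia. Qed.

Lemma revlex_lt_total (m n : 'X_{1..3}) : m != n -> revlex_lt m n || revlex_lt n m.
Proof.
move=> ne; rewrite !revlex_lt3; apply: contraR ne => h; apply/eqP.
by apply: mnm3P; move: h; clear; lia.
Qed.

(** [monomials] filters the monomials of degree below [d], hence the condition on [k]. *)
Lemma mem_monomials d k (m : 'X_{1..3}) : 0 < k ->
  (m \in monomials d k) = (mdeg m + k == d).
Proof.
move=> k0; rewrite /monomials mem_sort mem_filter andb_idr // => /eqP hd.
have md : mdeg m < d by rewrite -hd; clear -k0; lia.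
by apply/imageP; exists (BMultinom md).
Qed.

Lemma monomials_uniq d k : uniq (monomials d k).
Proof.
rewrite /monomials sort_uniq filter_uniq // map_inj_uniq ?enum_uniq //.
exact: val_inj.
Qed.

Lemma monomials_sorted d k : 0 < k -> pairwise revlex_lt (monomials d k).
Proof.
move=> k0.
have tr : transitive revlex_le.
  move=> n m p /orP[/eqP -> //|h1] /orP[/eqP <-|h2]; first by rewrite /revlex_le h1 orbT.
  by rewrite /revlex_le (revlex_lt_trans h1 h2) orbT.
have tot : total revlex_le.
  move=> m n; rewrite /revlex_le; case: (eqVneq m n) => //= ne.
  exact: revlex_lt_total.
have h : pairwise revlex_le (monomials d k).
  by rewrite -sorted_pairwise // sort_sorted.
have := monomials_uniq d k; rewrite uniq_pairwise => hu.
have : pairwise [rel m n | revlex_le m n && (m != n)] (monomials d k).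
  by rewrite pairwise_relI h.
by apply: sub_pairwise => m n /= /andP[/orP[->|]].
Qed.

(** Permuting the nodes 0, 1, ... permutes the columns of the Vandermonde matrix, so its determinant
    changes by the sign of [s]; in the product formula every inversion contributes one negative
    factor. *)
Lemma sign_Vandermonde n (s : 'S_n) :
  odd_perm s = odd (\sum_(i < n) \sum_(j < n) ((i < j) && (s j < s i))).
Proof.
pose a : 'rV[int]_n := (\row_j (j : nat)%:Z)%R.
pose a' : 'rV[int]_n := (\row_j (s j : nat)%:Z)%R.
have E : Vandermonde n a' = col_perm s (Vandermonde n a).
  by apply/matrixP => i j; rewrite !mxE.
have sgp (I : Type) (r : seq I) (Q : pred I) (F : I -> int) :
  Num.sg (\prod_(i <- r | Q i) F i)%R = (\prod_(i <- r | Q i) Num.sg (F i))%R.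
  exact: (big_morph _ (@sgrM _) (@sgr1 _)).
have pos : Num.sg (\prod_(i < n) \prod_(j < n | (i < j)%N) (a ord0 j - a ord0 i))%R = 1%R.
  rewrite gtr0_sg //; apply: prodr_gt0 => i _; apply: prodr_gt0 => j ij.
  by rewrite !mxE subr_gt0 ltz_nat.
have inv : Num.sg (\prod_(i < n) \prod_(j < n | (i < j)%N) (a' ord0 j - a' ord0 i))%R
    = ((-1) ^+ (\sum_(i < n) \sum_(j < n) ((i < j) && (s j < s i)))%N)%R.
  rewrite sgp expr_sum; apply: eq_bigr => i _; rewrite sgp expr_sum big_mkcond.
  apply: eq_bigr => j _; case: ifP => //= ij; rewrite !mxE.
  have : s i != s j by rewrite (inj_eq perm_inj) neq_ltn ij.
  rewrite -(inj_eq val_inj) neq_ltn => /orP[h|h].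
    by rewrite gtr0_sg ?subr_gt0 ?ltz_nat // ltnNge ltnW.
  by rewrite ltr0_sg ?subr_lt0 ?ltz_nat // h.
have := congr1 (fun A => Num.sg (determinant A)) E.
rewrite col_permE det_mulmx det_perm !det_Vandermonde odd_permV sgrM pos inv mul1r.
rewrite sgrX sgrN1 -signr_odd => e; apply: (@signr_inj int); exact/esym.
Qed.

Lemma pairwise_uniq (s : seq 'X_{1..3}) : pairwise revlex_lt s -> uniq s.
Proof.
rewrite uniq_pairwise; apply: sub_pairwise => m p /= h.
by apply/eqP => e; rewrite e revlex_lt_irr in h.
Qed.

Lemma pairwise_nth_lt (t : seq 'X_{1..3}) i j : pairwise revlex_lt t ->
  i < size t -> j < size t -> revlex_lt (nth 0%MM t i) (nth 0%MM t j) = (i < j).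
Proof.
move=> /(pairwiseP 0%MM) h hi hj; have [ij|ji|->] := ltngtP i j; first exact: h.
  apply/negbTE/negP => h'; have := revlex_lt_trans h' (h _ _ hj hi ji).
  by rewrite revlex_lt_irr.
exact: revlex_lt_irr.
Qed.

Section SeqSign.

Variables (s s' : seq 'X_{1..3}) (g : 'X_{1..3} -> 'X_{1..3}) (n : nat).
Hypotheses (sn : size s = n) (sn' : size s' = n).
Hypotheses (hs : pairwise revlex_lt s) (hs' : pairwise revlex_lt s').

Lemma odd_perm_inversions (sg : 'S_n) :
  (forall i : 'I_n, nth 0%MM s' (sg i) = g (nth 0%MM s i)) ->
  odd_perm sg = odd (\sum_(u <- s) \sum_(v <- s)
    (revlex_lt u v && revlex_lt (g v) (g u))).
Proof.
move=> hg; rewrite sign_Vandermonde; congr odd.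
rewrite (big_nth 0%MM) big_mkord sn; apply: eq_bigr => i _.
rewrite (big_nth 0%MM) big_mkord sn; apply: eq_bigr => j _.
by rewrite -!hg !pairwise_nth_lt ?sn ?sn'.
Qed.

Lemma seq_perm_exists : {in s, forall u, g u \in s'} -> {in s &, injective g} ->
  exists sg : 'S_n, forall i : 'I_n, nth 0%MM s' (sg i) = g (nth 0%MM s i).
Proof.
move=> gs ginj.
have mems (i : 'I_n) : nth 0%MM s i \in s by rewrite mem_nth // sn.
have h (i : 'I_n) : index (g (nth 0%MM s i)) s' < n.
  by rewrite (leq_trans _ (eq_leq sn')) // index_mem gs.
have inj : injective (fun i => Ordinal (h i)).
  move=> i j /(congr1 val) /= e; apply/val_inj => /=.
  have := congr1 (nth 0%MM s') e; rewrite !nth_index ?gs // => /ginj e'.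
  apply/eqP; rewrite -(nth_uniq 0%MM (s := s)) ?sn ?pairwise_uniq //.
  by rewrite e'.
by exists (perm inj) => i; rewrite permE /= nth_index // gs.
Qed.

End SeqSign.

(** * The perfect matching sign *)

Section Signs.

Variables (K : fieldType) (I : {pred {mpoly K[3]}}) (d : nat).
Hypothesis Iup : forall m m' : 'X_{1..3}, (m <= m')%MM -> 'X_[m] \in I -> 'X_[m'] \in I.

Let D := down I d.
Let U := up I d.
Let E := path_ends I d.

Lemma mem_down (n : 'X_{1..3}) :
  (n \in down I d) = ('X_[n] \notin I) && (n vx + n vy + n vz + 2 == d).
Proof. by rewrite mem_filter mem_monomials // mdeg3. Qed.

Lemma mem_up (u : 'X_{1..3}) :
  (u \in up I d) = ('X_[u] \notin I) && (u vx + u vy + u vz + 1 == d).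
Proof. by rewrite mem_filter mem_monomials // mdeg3. Qed.

Lemma mem_path_ends (u : 'X_{1..3}) : (u \in path_ends I d) =
  [&& 'X_[u] \in I, 0 < u vz & 'X_[u - U_(vz)] \notin I]
  && (u vx + u vy + u vz + 1 == d).
Proof. by rewrite mem_filter mem_monomials // mdeg3. Qed.

Lemma down_uniq : uniq (down I d).
Proof. by rewrite filter_uniq ?monomials_uniq. Qed.
Lemma up_uniq : uniq (up I d).
Proof. by rewrite filter_uniq ?monomials_uniq. Qed.
Lemma path_ends_uniq : uniq (path_ends I d).
Proof. by rewrite filter_uniq ?monomials_uniq. Qed.

Lemma mnm_addK (n : 'X_{1..3}) (i : 'I_3) : (n + U_(i) - U_(i))%MM = n.
Proof. by apply/mnmP => j; rewrite mnmBU mnmDU addnK. Qed.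

Lemma mnm_subK (n : 'X_{1..3}) (i : 'I_3) : 0 < n i -> (n - U_(i) + U_(i))%MM = n.
Proof.
move=> h; apply/mnmP => j; rewrite mnmDU mnmBU subnK //.
by case: eqP => [<-|].
Qed.

Lemma mnm_le_add (n : 'X_{1..3}) (i : 'I_3) : (n <= n + U_(i))%MM.
Proof. by apply/mnm_lepP => j; rewrite mnmDU leq_addr. Qed.

Lemma up_subz (u : 'X_{1..3}) : u \in U -> 0 < u vz -> (u - U_(vz))%MM \in D.
Proof.
rewrite mem_up mem_down => /andP[nI hd] u0; apply/andP; split.
  by apply: contra nI; apply: Iup; rewrite -{2}(mnm_subK u0) mnm_le_add.
by rewrite !mnmBU /=; move: hd u0; clear; lia.
Qed.

(** Each downward triangle has one z-neighbour, which either lies in the region or is a path end,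
    and all triangles of these two kinds with positive exponent of z arise in this way. *)
Lemma sum_addz (F : 'X_{1..3} -> nat) : \sum_(n <- D) F (n + U_(vz))%MM
  = \sum_(u <- U | 0 < u vz) F u + \sum_(e <- E) F e.
Proof.
rewrite -(big_map (fun n => (n + U_(vz))%MM) predT F).
rewrite -[X in _ = X + _]big_filter -big_cat /=.
apply/perm_big/uniq_perm.
- rewrite map_inj_uniq ?down_uniq // => m n /(congr1 (fun k => (k - U_(vz))%MM)).
  by rewrite !mnm_addK.
- rewrite cat_uniq filter_uniq ?up_uniq // path_ends_uniq andbT.
  apply/hasPn => e; rewrite mem_path_ends mem_filter mem_up => /andP[/and3P[-> _ _] _].
  by rewrite andbF.
move=> u; rewrite mem_cat mem_filter mem_up mem_path_ends.
apply/mapP/idP => [[n]|].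
  rewrite mem_down => /andP[nI hd] ->; rewrite mnm_addK nI.
  case: ('X_[_] \in I); rewrite /= !mnmDU /= ?addn1 ?addn0 /=;
  by move: hd; clear; lia.
have [u0|] /= := posnP (u vz); first by rewrite u0 /= !andbF.
move=> u0 h; exists (u - U_(vz))%MM; last by rewrite mnm_subK.
rewrite mem_down !mnmBU /=.
case/orP: h => /andP[h hd]; last first.
  by case/andP: h => _ ->; move: hd u0; clear; lia.
rewrite (_ : _ \notin I); first by move: hd u0; clear; lia.
by apply: contra h; apply: Iup; rewrite -{2}(mnm_subK u0) mnm_le_add.
Qed.

Section OneTiling.

Variable pi : 'X_{1..3} -> 'X_{1..3}.
Hypothesis hpi : lozenge_tiling I d pi.

Definition zfix (n : 'X_{1..3}) : bool := pi n == (n + U_(vz))%MM.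

Definition zmatched (u : 'X_{1..3}) : bool :=
  [&& 0 < u vz, (u - U_(vz))%MM \in D & pi (u - U_(vz))%MM == u].

Lemma sum_pi (F : 'X_{1..3} -> nat) : \sum_(n <- D) F (pi n) = \sum_(u <- U) F u.
Proof.
have [pU pinj psur _] := hpi.
rewrite -(big_map pi predT F); apply/perm_big/uniq_perm.
- by rewrite map_inj_in_uniq ?down_uniq.
- exact: up_uniq.
move=> u; apply/mapP/idP => [[n nD ->]|/psur[n nD <-]]; first exact: pU.
by exists n.
Qed.

Lemma zmatched_pi n : n \in D -> zmatched (pi n) = zfix n.
Proof.
have [pU pinj _ _] := hpi; move=> nD; apply/and3P/eqP => [[h0 hD /eqP e]|e].
  by rewrite -{2}(pinj _ _ hD nD e) mnm_subK.
by rewrite e mnm_addK mnmDU /= addn1 e.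
Qed.

Lemma zmatched_addz n : n \in D -> zmatched (n + U_(vz))%MM = zfix n.
Proof. by move=> nD; rewrite /zmatched mnm_addK mnmDU nD /= addn1. Qed.

Lemma zmatched_end e : e \in E -> zmatched e = false.
Proof.
have [pU _ _ _] := hpi; rewrite mem_path_ends => /andP[/andP[eI _] _].
apply/negbTE/negP => /and3P[_ /pU]; rewrite mem_up => /andP[h _] /eqP ee.
by move: h; rewrite ee eI.
Qed.

(** The exponent of y grows by at most one, and that of z grows only on [zfix]. Hence two triangles
    that both move in direction z, or both do not, keep their order; in an inversion [m] moves in
    direction z and [n] does not. *)
Lemma inversion_pair n m : n \in D -> m \in D ->
  revlex_lt n m && revlex_lt (pi m) (pi n) =
  [&& zfix m, ~~ zfix n & (n vz == m vz) && (m vy < n vy)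
                          || (n vz == m vz + 1) && (pi n vy < m vy)].
Proof.
have [pU pinj _ padj] := hpi; move=> nD mD.
have degU k : k \in D -> mdeg (pi k) + 1 = d.
  by move/pU; rewrite mem_up -mdeg3 => /andP[_ /eqP].
have degD k : k \in D -> mdeg k + 2 = d.
  by rewrite mem_down -mdeg3 => /andP[_ /eqP].
rewrite !revlex_ltE; last 2 first.
- by apply: (@addIn 1); rewrite !degU.
- by apply: (@addIn 2); rewrite !degD.
have fz k : k \in D -> pi k vz = k vz + zfix k /\ (zfix k -> pi k vy = k vy)
    /\ k vy <= pi k vy <= k vy + 1.
  move=> kD; rewrite /zfix; case: (adjacentP _ _ (padj k kD)) => e; rewrite e ?eqxx.
  - rewrite !mnmDU /= (_ : _ == _ = false); first by rewrite !addn0; clear; lia.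
    by apply/eqP => /(congr1 (fun k : 'X_{1..3} => k vz)); rewrite !mnmDU /=; clear; lia.
  - rewrite !mnmDU /= (_ : _ == _ = false); first by rewrite !addn0; clear; lia.
    by apply/eqP => /(congr1 (fun k : 'X_{1..3} => k vz)); rewrite !mnmDU /=; clear; lia.
  by rewrite !mnmDU /=; clear; lia.
have [ezn [eyn hyn]] := fz n nD; have [ezm [eym hym]] := fz m mD.
rewrite ezn ezm; case: (zfix n) eyn => eyn; case: (zfix m) eym => eym;
  rewrite ?(eyn isT) ?(eym isT) /=; clear -hyn hym; lia.
Qed.

(** Complementary to the paths passing [e]: it counts lozenges of direction z, and its difference
    for two tilings is [hdiff] at [e]. *)
Definition below (e : 'X_{1..3}) : nat :=
  \sum_(m <- D | zfix m) ((e vz == m vz + 1) && (m vy < e vy)).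

(** The number of lattice paths that continue past level [s]. *)
Definition alive (s : nat) : nat := \sum_(u <- U | ~~ zmatched u) (u vz == s).

(** Fix [m] moving in direction z and record each [n] inverted with it on the level of [pi m]:
    through its z-neighbour if [n] has the level of [m], through [pi n] otherwise. This exhausts the
    path points counted by [alive] there; the z-neighbours that are path ends give the term with
    [below]. *)
Lemma inversions_pi :
  \sum_(n <- D) \sum_(m <- D) (revlex_lt n m && revlex_lt (pi m) (pi n)) =
  \sum_(m <- D | zfix m) alive (m vz + 1) + \sum_(e <- E) below e.
Proof.
have [pU pinj _ padj] := hpi.
have -> : \sum_(e <- E) below e = \sum_(m <- D | zfix m) \sum_(e <- E)
    ((e vz == m vz + 1) && (m vy < e vy)) by rewrite /below exchange_big.
rewrite exchange_big /= -big_split /=.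
rewrite [RHS]big_mkcond /= big_seq [RHS]big_seq; apply: eq_bigr => m mD.
transitivity (\sum_(n <- D) ([&& zfix m, ~~ zfix n &
    (n vz == m vz) && (m vy < n vy) || (n vz == m vz + 1) && (pi n vy < m vy)] : nat)).
  by rewrite big_seq [RHS]big_seq; apply: eq_bigr => n nD; rewrite inversion_pair.
have [zm|nzm] := ifP; last by rewrite big1.
pose h1 (v : 'X_{1..3}) := (~~ zmatched v && ((v vz == m vz + 1) && (m vy < v vy)) : nat).
pose h2 (v : 'X_{1..3}) := (~~ zmatched v && ((v vz == m vz + 1) && (v vy < m vy)) : nat).
transitivity (\sum_(n <- D) h1 (n + U_(vz))%MM + \sum_(n <- D) h2 (pi n)).
  rewrite -big_split /= big_seq [RHS]big_seq; apply: eq_bigr => n nD.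
  rewrite /h1 /h2 zmatched_pi // zmatched_addz // !mnmDU /= addn0 eqn_add2r.
  case zn: (zfix n) => //=.
  have -> : pi n vz = n vz.
    have [e|e|e] := adjacentP _ _ (padj n nD); rewrite ?e ?mnmDU ?addn0 //.
    by move: zn; rewrite /zfix e eqxx.
  case: (n vz =P m vz) => [->|_] //=.
  by rewrite (_ : _ == _ + 1 = false) ?orbF ?addn0 //; clear; lia.
rewrite (sum_pi h2) (sum_addz h1) addnAC; congr (_ + _); last first.
  rewrite big_seq [RHS]big_seq; apply: eq_bigr => e eE.
  by rewrite /h1 zmatched_end.
rewrite big_mkcond -big_split /= /alive [RHS]big_mkcond /= big_seq [RHS]big_seq.
apply: eq_bigr => u uU; rewrite /h1 /h2.
case zu: (zmatched u) => /=; first by case: ifP.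
case: (u vz =P m vz + 1) => [e|_] /=; last by case: ifP.
rewrite e addn1 /=; case: (ltngtP (m vy) (u vy)) => //= ey.
(* The remaining case of equal exponents of y is [pi m] itself, which is matched in direction z. *)
move: zu; rewrite (_ : u = (m + U_(vz))%MM) ?zmatched_addz ?zm //.
move: mD uU; rewrite mem_down mem_up => /andP[_ /eqP hm] /andP[_ /eqP hu].
by apply: mnm3P; rewrite !mnmDU /= -?ey ?e //; move: hm hu; rewrite e -ey; clear; lia.
Qed.

Definition zcount (s : nat) : nat := \sum_(m <- D | zfix m) (m vz + 1 == s).

Lemma alive_zcount s : alive s + zcount s = \sum_(u <- U) (u vz == s).
Proof.
have -> : zcount s = \sum_(u <- U | zmatched u) (u vz == s).
  rewrite [RHS]big_mkcond -sum_pi /zcount big_mkcond big_seq [RHS]big_seq.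
  apply: eq_bigr => n nD; rewrite zmatched_pi //; case: ifP => // /eqP ->.
  by rewrite mnmDU.
by rewrite [RHS](bigID zmatched) /= addnC.
Qed.

Lemma zcountS_alive s : zcount s.+1 + alive s = \sum_(n <- D) (n vz == s).
Proof.
have [_ _ _ padj] := hpi.
have -> : alive s = \sum_(n <- D | ~~ zfix n) (n vz == s).
  rewrite /alive big_mkcond -sum_pi [RHS]big_mkcond big_seq [RHS]big_seq.
  apply: eq_bigr => n nD; rewrite zmatched_pi //; case: ifP => // zn.
  have [e|e|e] := adjacentP _ _ (padj n nD); rewrite ?e ?mnmDU ?addn0 //.
  by move: zn; rewrite /zfix e eqxx.
rewrite [RHS](bigID zfix) /= /zcount; congr (_ + _).
by apply: eq_bigr => m _; rewrite addn1 eqSS.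
Qed.

Lemma zcount0 : zcount 0 = 0.
Proof. by rewrite /zcount big1 // => m _; rewrite addn1. Qed.

End OneTiling.

(** Level by level: counting upward triangles determines [alive] from [zcount] at level [s], and
    counting downward ones then determines [zcount] at level [s.+1]. *)
Lemma alive_zcount_eq pi1 pi2 : lozenge_tiling I d pi1 -> lozenge_tiling I d pi2 ->
  forall s, alive pi1 s = alive pi2 s /\ zcount pi1 s = zcount pi2 s.
Proof.
move=> h1 h2; elim=> [|s [IHa IHz]].
  have := alive_zcount h1 0; rewrite -(alive_zcount h2 0) !zcount0 !addn0.
  by move=> ->.
have ez : zcount pi1 s.+1 = zcount pi2 s.+1.
  by apply: (@addIn (alive pi1 s)); rewrite {2}IHa !zcountS_alive.
split => //; apply: (@addIn (zcount pi1 s.+1)).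
by rewrite {2}ez !alive_zcount.
Qed.

Lemma sum_alive_eq pi1 pi2 : lozenge_tiling I d pi1 -> lozenge_tiling I d pi2 ->
  \sum_(m <- D | zfix pi1 m) alive pi1 (m vz + 1) =
  \sum_(m <- D | zfix pi2 m) alive pi2 (m vz + 1).
Proof.
have expand pi : \sum_(m <- D | zfix pi m) alive pi (m vz + 1)
    = \sum_(s < d.+1) zcount pi s * alive pi s.
  rewrite /zcount; under [RHS]eq_bigr do rewrite big_distrl /=.
  rewrite [RHS]exchange_big /= big_seq_cond [RHS]big_seq_cond; apply: eq_bigr => m /andP[mD _].
  have lt : m vz + 1 < d.+1.
    by move: mD; rewrite mem_down => /andP[_]; clear; lia.
  rewrite (bigD1 (Ordinal lt)) //= eqxx mul1n big1 ?addn0 // => i.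
  by rewrite -(inj_eq val_inj) eq_sym /= => /negbTE ->.
move=> h1 h2; rewrite !expand; apply: eq_bigr => s _.
by have [-> ->] := alive_zcount_eq h1 h2 s.
Qed.

End Signs.

(** * The lattice path sign *)

Section Paths.

Variables (K : fieldType) (I : {pred {mpoly K[3]}}) (d : nat).
Hypothesis Iup : forall m m' : 'X_{1..3}, (m <= m')%MM -> 'X_[m] \in I -> 'X_[m'] \in I.

Let D := down I d.
Let U := up I d.
Let E := path_ends I d.

Variable pi : 'X_{1..3} -> 'X_{1..3}.
Hypothesis hpi : lozenge_tiling I d pi.

Definition on_path (v : 'X_{1..3}) : bool :=
  ((v \in U) || (v \in E)) && ~~ zmatched I d pi v.

Definition prev (v : 'X_{1..3}) : 'X_{1..3} := pi (v - U_(vz))%MM.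

Lemma on_path_deg v : on_path v -> v vx + v vy + v vz + 1 = d.
Proof.
by case/andP=> /orP[]; rewrite ?mem_up ?mem_path_ends => /andP[_ /eqP].
Qed.

Lemma on_path_eq v v' : on_path v -> on_path v' -> v vz = v' vz -> v vy = v' vy ->
  v = v'.
Proof.
move=> /on_path_deg h /on_path_deg h' hz hy; apply: mnm3P => //.
by move: h h'; rewrite hz hy; clear; lia.
Qed.

Lemma up_not_end u : u \in U -> u \in E -> False.
Proof. by rewrite mem_up mem_path_ends => /andP[/negbTE -> _] /andP[/andP[]]. Qed.

Lemma on_path_up u : u \in U -> ~~ zmatched I d pi u -> on_path u.
Proof. by move=> uU uz; rewrite /on_path uU. Qed.

Lemma on_path_end e : e \in E -> on_path e.
Proof. by move=> eE; rewrite /on_path eE orbT zmatched_end. Qed.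

Lemma on_path_sub v : on_path v -> 0 < v vz ->
  (v - U_(vz))%MM \in D /\ ~~ zfix pi (v - U_(vz))%MM.
Proof.
move=> /andP[hv nz] v0.
have vD : (v - U_(vz))%MM \in D.
  case/orP: hv => [vU|]; first exact: up_subz.
  rewrite mem_path_ends mem_down => /andP[/and3P[_ _ ->]].
  by rewrite !mnmBU /=; move: v0; clear; lia.
by split=> //; apply: contra nz => zf; rewrite /zmatched v0 vD -[X in _ == X](mnm_subK v0).
Qed.

Lemma step_coord n : n \in D -> ~~ zfix pi n ->
  pi n vz = n vz /\ n vy <= pi n vy <= n vy + 1.
Proof.
have [_ _ _ padj] := hpi; rewrite /zfix => nD nz.
have [e|e|e] := adjacentP _ _ (padj n nD); rewrite e ?mnmDU /=.
- by clear; lia.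
- by clear; lia.
by rewrite e eqxx in nz.
Qed.

Lemma prev_on_path v : on_path v -> 0 < v vz ->
  [/\ prev v \in U, on_path (prev v) & (prev v vz).+1 = v vz].
Proof.
have [pU _ _ _] := hpi; move=> hv v0; have [vD nz] := on_path_sub hv v0.
split; first exact: pU.
  by apply: on_path_up; rewrite ?zmatched_pi // pU.
by have [-> _] := step_coord vD nz; rewrite mnmBU /= subn1 prednK.
Qed.

(** Paths do not cross: one step back raises the exponent of y by at most one, and injectivity of
    the tiling keeps two paths from merging. *)
Lemma prev_lt v v' : on_path v -> on_path v' -> v vz = v' vz -> 0 < v vz ->
  v vy < v' vy -> prev v vy < prev v' vy.
Proof.
have [_ pinj _ _] := hpi; move=> hv hv' ez v0 hy.
have v0' : 0 < v' vz by rewrite -ez.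
have [vD nz] := on_path_sub hv v0; have [vD' nz'] := on_path_sub hv' v0'.
have [_ h1] := step_coord vD nz; have [_ h2] := step_coord vD' nz'.
have [_ p1 e1] := prev_on_path hv v0; have [_ p2 e2] := prev_on_path hv' v0'.
rewrite ltn_neqAle; apply/andP; split; last first.
  by move: h1 h2 hy; rewrite !mnmBU /= /prev; clear; lia.
apply/eqP => e; have ezz : prev v vz = prev v' vz by move: e1 e2; rewrite ez; clear; lia.
have := on_path_eq p1 p2 ezz e; move/(pinj _ _ vD vD')=> /(congr1 (fun k : 'X_{1..3} => k vy)).
by rewrite !mnmBU /=; move: hy; clear; lia.
Qed.

Lemma iter_prev k v : on_path v -> k <= v vz ->
  [/\ on_path (iter k prev v), iter k prev v vz = v vz - k
    & 0 < k -> iter k prev v \in U].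
Proof.
move=> hv; elim: k => [|k IH] hk; first by rewrite /= subn0.
have [h1 h2 _] := IH (ltnW hk).
have [|h3 h4 h5] := prev_on_path h1; first by rewrite h2 subn_gt0.
by rewrite iterS; split => //; move: h5; rewrite h2; clear -hk; lia.
Qed.

Lemma iter_prev_lt k v v' : on_path v -> on_path v' -> v vz = v' vz -> k <= v vz ->
  v vy < v' vy -> iter k prev v vy < iter k prev v' vy.
Proof.
move=> hv hv' ez; elim: k => // k IH hk hy; rewrite !iterS.
have [h1 h2 _] := iter_prev hv (ltnW hk).
have [|h1' h2' _] := @iter_prev k v' hv'; first by rewrite -ez ltnW.
apply: prev_lt => //; first by rewrite h2 h2' ez.
  by rewrite h2 subn_gt0.
exact: IH (ltnW hk) hy.
Qed.

Lemma iter_prev_inj k v v' : on_path v -> on_path v' -> v vz = v' vz -> k <= v vz ->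
  iter k prev v = iter k prev v' -> v = v'.
Proof.
move=> hv hv' ez hk e; apply: on_path_eq => //.
have [hy|hy|//] := ltngtP (v vy) (v' vy).
  by have := iter_prev_lt hv hv' ez hk hy; rewrite e ltnn.
by have := @iter_prev_lt k _ _ hv' hv (esym ez); rewrite -ez e ltnn => /(_ hk hy).
Qed.

Definition at_level (t : nat) (e : 'X_{1..3}) : 'X_{1..3} := iter (e vz - t) prev e.

Lemma at_levelP t e : e \in E -> t < e vz ->
  [/\ at_level t e \in U, on_path (at_level t e) & at_level t e vz = t].
Proof.
move=> eE te; have [|h1 h2 h3] := @iter_prev (e vz - t) e (on_path_end eE).
  exact: leq_subr.
by split => //; [apply: h3; rewrite subn_gt0 | rewrite h2 subKn // ltnW].
Qed.

Lemma at_level_iter t s (e : 'X_{1..3}) : t <= s <= e vz ->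
  at_level t e = iter (s - t) prev (at_level s e).
Proof.
by move=> h; rewrite /at_level -iterD; congr iter; move: h; clear; lia.
Qed.

(** Ends on one level are separated by [iter_prev_inj]. For ends on different levels, equality would
    put one end on the path of the other at a point of [U], but path ends are not in [U]. *)
Lemma at_level_inj t : {in E &, forall e e' : 'X_{1..3}, t < e vz -> t < e' vz ->
  at_level t e = at_level t e' -> e = e'}.
Proof.
suff h (e e' : 'X_{1..3}) : e \in E -> e' \in E -> t < e vz -> e vz <= e' vz ->
    at_level t e = at_level t e' -> e = e'.
  move=> e e' eE eE' t1 t2 ee; case: (leqP (e vz) (e' vz)) => le.
    exact: h ee.
  by apply/esym; apply: h (esym ee) => //; apply: ltnW.
move=> eE eE' te le ee.
have [le'|ez] : e vz < e' vz \/ e vz = e' vz by move: le; clear; lia.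
  have [h1 h2 h3] := at_levelP eE' le'.
  case: (up_not_end h1); rewrite -(_ : e = at_level (e vz) e') //.
  apply: (@iter_prev_inj (e vz - t)) => //; [exact: on_path_end|exact: leq_subr|].
  by rewrite -at_level_iter // ltnW.
move: ee; rewrite /at_level -ez; apply: iter_prev_inj => //; try exact: on_path_end.
exact: leq_subr.
Qed.

(** Follow the path forwards: [u] is [pi n], and the next point [n + U_(vz)] is either a path end or
    again an upward triangle on a path, one level further. *)
Lemma at_level_surj u : u \in U -> ~~ zmatched I d pi u ->
  exists2 e, e \in E & (u vz < e vz) && (at_level (u vz) e == u).
Proof.
have [_ _ psur _] := hpi.
have [k le_k] := ubnP (d - u vz); elim: k u le_k => // k IH u le_k uU uz.
have [n nD en] := psur u uU.
have nz : ~~ zfix pi n by rewrite -(zmatched_pi hpi nD) en.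
have [ez _] := step_coord nD nz; rewrite en in ez.
have vz : (n + U_(Defs.vz))%MM Defs.vz = (u Defs.vz).+1 by rewrite mnmDU ez addn1.
have pv : prev (n + U_(Defs.vz))%MM = u by rewrite /prev mnm_addK.
have [nI|nI] := boolP ('X_[n + U_(Defs.vz)] \in I).
  exists (n + U_(Defs.vz))%MM; last by rewrite /at_level vz ltnSn subSnn /= pv.
  rewrite mem_path_ends nI mnm_addK vz /=; move: nD; rewrite mem_down => /andP[-> hn] /=.
  by rewrite mnmDU mnmDU /=; move: hn vz; rewrite mnmDU /=; clear; lia.
have vU : (n + U_(Defs.vz))%MM \in U.
  rewrite mem_up nI; move: nD; rewrite mem_down => /andP[_ hn].
  by rewrite !mnmDU /=; move: hn; clear; lia.
have [||e eE /andP[h1 /eqP h2]] := IH (n + U_(Defs.vz))%MM _ vU.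
- by move: uU; rewrite mem_up vz => /andP[_]; move: le_k; clear; lia.
- by rewrite zmatched_addz.
exists e => //; rewrite vz in h1 h2; rewrite ltnW //=.
by rewrite (@at_level_iter _ (u Defs.vz).+1) ?h2 ?subSnn /= ?pv // leqnSn ltnW.
Qed.

Lemma sum_at_level (F : 'X_{1..3} -> nat) t :
  \sum_(e <- E | t < e vz) F (at_level t e) =
  \sum_(u <- U | ~~ zmatched I d pi u && (u vz == t)) F u.
Proof.
rewrite -big_filter -[RHS]big_filter -(big_map (at_level t) predT F).
apply/perm_big/uniq_perm.
- rewrite map_inj_in_uniq; first by apply: filter_uniq; exact: path_ends_uniq.
  move=> e e'.
  rewrite mem_filter => /andP[te eE]; rewrite mem_filter => /andP[te' eE'].
  exact: (at_level_inj eE eE' te te').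
- by apply: filter_uniq; exact: up_uniq.
move=> u; rewrite mem_filter; apply/mapP/idP => [[e]|/andP[/andP[uz /eqP <-] uU]].
  rewrite mem_filter => /andP[te eE] ->; have [h1 /andP[_ h2] h3] := at_levelP eE te.
  by rewrite h1 h2 h3 eqxx.
have [e eE /andP[h1 /eqP h2]] := at_level_surj uU uz.
by exists e; rewrite ?h2 // mem_filter h1.
Qed.

Lemma end_z_gt0 e : e \in E -> 0 < e vz.
Proof. by rewrite mem_path_ends => /andP[/and3P[]]. Qed.

(* Each path is followed backwards from its end, because [prev] is explicit
   whereas a forward step needs the inverse of the tiling. *)
Definition path_start (e : 'X_{1..3}) : 'X_{1..3} := at_level 0 e.

Lemma path_start_in : {in E, forall e : 'X_{1..3}, path_start e \in path_starts I d}.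
Proof.
move=> e eE; have [h1 _ h3] := at_levelP eE (end_z_gt0 eE).
by rewrite mem_filter h3 h1.
Qed.

Lemma path_start_inj : {in E &, injective path_start}.
Proof. by move=> e e' eE eE'; apply: at_level_inj => //; exact: end_z_gt0. Qed.

Lemma size_path_starts : size (path_starts I d) = size (path_ends I d).
Proof.
rewrite -!sum1_size big_filter; have := sum_at_level (fun=> 1) 0.
rewrite [X in X = _](_ : _ = \sum_(e <- E) 1); last first.
  by rewrite big_seq_cond [RHS]big_seq; apply: eq_bigl => e; rewrite andb_idr // => /end_z_gt0.
move=> ->; apply: eq_bigl => u; case: eqP => [e|_]; last by rewrite andbF.
by rewrite andbT /zmatched e.
Qed.

Lemma path_ends_at_start e : e \in E -> path_ends_at I d pi (path_start e) e.
Proof.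
have [pU _ _ padj] := hpi; move=> eE; split; last first.
  move=> w; apply/hasPn => n nD; apply/negP => /and3P[/eqP en _ _].
  by apply: (@up_not_end e) => //; rewrite en pU.
rewrite /path_start /at_level subn0.
suff gen k : k <= e vz -> exists2 p : seq 'X_{1..3},
    path (path_step I d pi) (iter k prev e) p & last (iter k prev e) p = e.
  exact: gen.
elim: k => [|k IH] hk; first by exists [::].
have [p hp lp] := IH (ltnW hk).
have [h1 h2 _] := iter_prev (on_path_end eE) (ltnW hk).
exists (iter k prev e :: p) => //=; rewrite hp andbT.
have v0 : 0 < iter k prev e vz by rewrite h2 subn_gt0.
have [vD nz] := on_path_sub h1 v0.
apply/hasP; exists (iter k prev e - U_(vz))%MM => //.
rewrite eqxx mnm_subK // eqxx andbT /=.
have [->|->|ee] := adjacentP _ _ (padj _ vD); rewrite ?eqxx ?orbT //.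
by rewrite /zfix ee eqxx in nz.
Qed.

Definition above (e : 'X_{1..3}) : nat :=
  \sum_(u <- U | ~~ zmatched I d pi u) ((u vz == e vz) && (u vy < e vy)).

(** An upward triangle is either matched in direction z or on a path, so the total depends on the
    region only. This ties the two signs together. *)
Lemma above_below e : above e + below I d pi e =
  \sum_(u <- U) ((u vz == e vz) && (u vy < e vy)).
Proof.
have -> : below I d pi e =
    \sum_(u <- U | zmatched I d pi u) ((u vz == e vz) && (u vy < e vy)).
  rewrite [RHS]big_mkcond -(sum_pi hpi) /below big_mkcond big_seq [RHS]big_seq.
  apply: eq_bigr => n nD; rewrite zmatched_pi //; case: ifP => // /eqP ->.
  by rewrite !mnmDU /= addn0 eq_sym.
by rewrite [RHS](bigID (zmatched I d pi)) /= addnC.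
Qed.

(** Paths keep their order from level to level. Ends on one level thus give no inversion, and
    otherwise the order of the starts is read off where one path passes the level of the other
    end. *)
Lemma inversion_start e e' : e \in E -> e' \in E ->
  revlex_lt e e' && revlex_lt (path_start e') (path_start e) =
  (e' vz < e vz) && (at_level (e' vz) e vy < e' vy).
Proof.
move=> eE eE'.
have [U1 p1 z1] := at_levelP eE (end_z_gt0 eE).
have [U2 p2 z2] := at_levelP eE' (end_z_gt0 eE').
have hd v v' : on_path v -> on_path v' -> mdeg v = mdeg v'.
  move=> /on_path_deg h /on_path_deg h'.
  by apply: (@addIn 1); rewrite !mdeg3 h h'.
have q1 := on_path_end eE; have q2 := on_path_end eE'.
rewrite !revlex_ltE; try exact: hd.
rewrite /path_start z1 z2 ltnn eqxx /=.
have [lt|lt|ez] /= := ltngtP (e' vz) (e vz); last 2 first.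
- by [].
- apply/negbTE/negP => /andP[h1 h2].
  have := iter_prev_lt q2 q1 ez (leqnn _) h1.
  rewrite {2}ez => h3; move: h2; rewrite /at_level !subn0 => h2.
  by have := ltn_trans h2 h3; rewrite ltnn.
have [U3 p3 z3] := at_levelP eE lt.
have -> : at_level 0 e = iter (e' vz) prev (at_level (e' vz) e).
  by rewrite (@at_level_iter 0 (e' vz)) ?subn0 // (ltnW lt).
have -> : at_level 0 e' = iter (e' vz) prev e' by rewrite /at_level subn0.
have [h|h|h] := ltngtP (at_level (e' vz) e vy) (e' vy).
- by apply: iter_prev_lt; rewrite ?z3.
- apply/negbTE; rewrite -leqNgt ltnW //.
  by apply: iter_prev_lt; rewrite ?z3.
by case: (up_not_end U3); rewrite (on_path_eq p3 q2).
Qed.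

Lemma inversions_start :
  \sum_(e <- E) \sum_(e' <- E)
    (revlex_lt e e' && revlex_lt (path_start e') (path_start e)) =
  \sum_(e <- E) above e.
Proof.
rewrite exchange_big /= big_seq [RHS]big_seq; apply: eq_bigr => e' eE'.
pose F (u : 'X_{1..3}) := ((u vy < e' vy) : nat).
transitivity (\sum_(e <- E | e' vz < e vz) F (at_level (e' vz) e)).
  rewrite [RHS]big_mkcond big_seq [RHS]big_seq; apply: eq_bigr => e eE.
  by rewrite inversion_start //; case: (_ < _).
rewrite sum_at_level /above /F big_mkcondr; apply: eq_bigr => u _.
by case: (_ == _).
Qed.

Lemma perfect_matching_perm n : size (down I d) = n -> size (up I d) = n ->
  exists2 sg : 'S_n,
    forall i : 'I_n, nth 0%MM (up I d) (sg i) = pi (nth 0%MM (down I d) i)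
    & odd_perm sg = odd (\sum_(m <- D | zfix pi m) alive I d pi (m vz + 1)
                         + \sum_(e <- E) below I d pi e).
Proof.
have [pU pinj _ _] := hpi; move=> sD sU.
have pwD : pairwise revlex_lt (down I d) by apply: pairwise_filter; apply: monomials_sorted.
have pwU : pairwise revlex_lt (up I d) by apply: pairwise_filter; apply: monomials_sorted.
have [sg hsg] := seq_perm_exists sD sU pwD pU pinj.
exists sg => //; rewrite (odd_perm_inversions sD sU pwD pwU hsg).
by rewrite inversions_pi.
Qed.

Lemma lattice_path_perm : exists2 la : 'S_(size (path_starts I d)),
    forall i : 'I_(size (path_starts I d)),
      path_ends_at I d pi (nth 0%MM (path_starts I d) i) (nth 0%MM (path_ends I d) (la i))
    & odd_perm la = odd (\sum_(e <- E) above e).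
Proof.
have sE := esym size_path_starts.
have pwE : pairwise revlex_lt (path_ends I d) by apply: pairwise_filter; apply: monomials_sorted.
have pwA : pairwise revlex_lt (path_starts I d).
  by do 2!apply: pairwise_filter; apply: monomials_sorted.
have [tau htau] := seq_perm_exists sE (erefl _) pwE path_start_in path_start_inj.
(* [tau] leads from ends to starts, the lattice path permutation the other way; the parity is the
   same. *)
exists tau^-1%g => [i|].
  have := htau (tau^-1%g i); rewrite permKV => ->; apply: path_ends_at_start.
  by rewrite mem_nth // sE.
rewrite odd_permV (odd_perm_inversions sE (erefl _) pwE pwA htau).
by rewrite inversions_start.
Qed.

End Paths.

(** * Punctures *)

Section Ideal.

Variables (K : fieldType) (G : 'X_{1..3} -> Prop) (J : {pred {mpoly K[3]}}).
Hypothesis hJ : generated_by G J.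

Lemma generated_mul (p q : {mpoly K[3]}) : p \in J -> (q * p)%R \in J.
Proof.
move/hJ=> [s hs ->]; apply/hJ; exists [seq ((q * c.1)%R, c.2) | c <- s].
  by move=> _ /mapP[c cs ->] /=; apply: hs.
by rewrite big_map mulr_sumr; apply: eq_bigr => c _; rewrite mulrA.
Qed.

Lemma generated_up (m m' : 'X_{1..3}) :
  (m <= m')%MM -> 'X_[m] \in J -> 'X_[m'] \in J.
Proof. by move=> le h; rewrite -(submK le) mpolyXD; apply: generated_mul. Qed.

Lemma generated_gen (m : 'X_{1..3}) : G m -> 'X_[m] \in J.
Proof.
move=> gm; apply/hJ; exists [:: (1%R, m)].
  by move=> c; rewrite inE => /eqP ->.
by rewrite big_seq1 mul1r.
Qed.

End Ideal.

Section Punctures.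

Variables (K : fieldType) (I : {pred {mpoly K[3]}}) (d : nat).
Hypothesis Iup : forall m m' : 'X_{1..3}, (m <= m')%MM -> 'X_[m] \in I -> 'X_[m'] \in I.

Let box : seq 'X_{1..3} := [seq bmnm b | b : 'X_{1..3 < d}].

(** These are the monomials that may generate an ideal with the same region. *)
Definition hole (m : 'X_{1..3}) : bool :=
  (mdeg m < d) && all (fun w => (m <= w)%MM ==> ('X_[w] \in I))
                      (monomials d 1 ++ monomials d 2).

(** Maximal as a triangle, hence minimal for divisibility. *)
Definition maximal_hole (m : 'X_{1..3}) : bool :=
  hole m && all (fun m' => hole m' && (m' <= m)%MM ==> (m' == m)) box.

(** The ideal J(T). Membership is boolean because it is read off the support and all holes lie in
    the finite [box]. *)
Definition hole_ideal : {pred {mpoly K[3]}} := fun p =>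
  all (fun w => has (fun m => hole m && (m <= w)%MM) box) (msupp p).

Lemma mem_box (m : 'X_{1..3}) : (m \in box) = (mdeg m < d).
Proof.
apply/imageP/idP => [[b _ ->]|h]; first exact: bmdeg.
by exists (BMultinom h).
Qed.

Lemma holeP (m : 'X_{1..3}) : reflect (mdeg m < d /\
    forall w : 'X_{1..3}, (m <= w)%MM -> (mdeg w + 1 == d) || (mdeg w + 2 == d) ->
      'X_[w] \in I)
  (hole m).
Proof.
apply: (iffP andP) => -[h1 h2]; split => //.
  move=> w le hw; move/allP: h2 => /(_ w); rewrite le /= => -> //.
  by rewrite mem_cat !mem_monomials.
apply/allP => w; rewrite mem_cat !mem_monomials // => hw.
by apply/implyP => le; apply: h2.
Qed.

Lemma maximal_holeP (m : 'X_{1..3}) :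
  reflect (hole m /\ forall m', hole m' -> (m' <= m)%MM -> m' = m) (maximal_hole m).
Proof.
apply: (iffP andP) => -[h1 h2]; split => //.
  move=> m' h le; move/allP: h2 => /(_ m'); rewrite h le /= mem_box => h2.
  by apply/eqP/h2; case/holeP: h.
by apply/allP => m' _; apply/implyP => /andP[h le]; apply/eqP; apply: h2.
Qed.

Lemma hole_above (m : 'X_{1..3}) : hole m ->
  exists2 m', maximal_hole m' & (m' <= m)%MM.
Proof.
have [k le_k] := ubnP (mdeg m); elim: k m le_k => // k IH m le_k hm.
have [mm|] := boolP (maximal_hole m); first by exists m => //; apply: lepm_refl.
rewrite negb_and hm /= => /allPn[m' _]; rewrite negb_imply => /andP[/andP[hm' le] ne].
have [|m'' h'' le''] := IH m' _ hm'; last by exists m'' => //; apply: lepm_trans le.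
move: le_k le ne; rewrite !mdeg3 mnm_le3 => le_k /and3P[lx ly lz] ne.
have : ~ (m' vx = m vx /\ m' vy = m vy /\ m' vz = m vz).
  by case=> ex [ey ez]; case/eqP: ne; apply: mnm3P.
by move: le_k lx ly lz; clear; lia.
Qed.

Lemma mem_hole_ideal (w : 'X_{1..3}) :
  reflect (exists2 m, hole m & (m <= w)%MM) ('X_[w] \in hole_ideal).
Proof.
rewrite /hole_ideal unfold_in msuppX /= andbT.
apply: (iffP hasP) => [[m _ /andP[h le]]|[m h le]]; first by exists m.
by exists m; rewrite ?h ?le // mem_box; case/holeP: h.
Qed.

Lemma hole_ideal_generated : generated_by hole hole_ideal.
Proof.
move=> p; split.
  rewrite /hole_ideal unfold_in => /allP h.
  pose g w := nth 0%MM box (find (fun m => hole m && (m <= w)%MM) box).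
  have hg w : w \in msupp p -> hole (g w) /\ (g w <= w)%MM.
    by move/h => hb; have /andP[] := nth_find 0%MM hb.
  exists [seq ((p@_w *: 'X_[w - g w])%R, g w) | w <- msupp p].
    by move=> _ /mapP[w /hg[hw _] ->].
  rewrite big_map {1}(mpolyE p) big_seq [RHS]big_seq; apply: eq_bigr => w /hg[_ le] /=.
  by rewrite -scalerAl -mpolyXD submK.
move=> [s hs ->]; rewrite /hole_ideal unfold_in; apply/allP => w /msupp_sum_le.
move=> /flattenP[r /mapP[c]]; rewrite filter_predT => cs ->.
rewrite (perm_mem (msuppMX _ _)) => /mapP[m' _ ->]; apply/hasP; exists c.2.
  by rewrite mem_box; case/holeP: (hs c cs).
by rewrite hs //= lem_addr.
Qed.

Lemma hole_monomial (w : 'X_{1..3}) k : 0 < k <= 2 -> mdeg w + k = d ->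
  'X_[w] \in I -> hole w.
Proof.
move=> hk hd wI; apply/holeP; split; first by move: hk hd; clear; lia.
by move=> w' le _; apply: Iup wI.
Qed.

Lemma hole_ideal_region : same_region I d hole_ideal.
Proof.
have h k : 0 < k <= 2 -> {in monomials d k, forall w : 'X_{1..3},
    ('X_[w] \in hole_ideal) = ('X_[w] \in I)}.
  move=> hk w; rewrite mem_monomials ?(proj1 (andP hk)) // => /eqP hd.
  apply/mem_hole_ideal/idP => [[m /holeP[_ h] le]|wI].
    by apply: h => //; move: hk hd; clear; lia.
  by exists w; [apply: (hole_monomial hk) | apply: lepm_refl].
by split; apply: eq_in_filter => w wd /=; rewrite (h _ _ w wd).
Qed.

Lemma hole_ideal_largest J' : monomial_ideal_below d J' -> same_region I d J' ->
  {subset J' <= hole_ideal}.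
Proof.
move=> [G hG gen] [hD hU] p /gen[s hs ->].
apply/hole_ideal_generated; exists s => // c /hs gc; apply/holeP.
split; first exact: hG.
move=> w le hd; have wJ : 'X_[w] \in J' by apply: generated_up gen _ _ le (generated_gen gen gc).
apply/negPn/negP => wI; case/orP: hd => hd.
  have : w \in up I d by rewrite mem_filter wI mem_monomials.
  by rewrite -hU mem_filter wJ.
have : w \in down I d by rewrite mem_filter wI mem_monomials.
by rewrite -hD mem_filter wJ.
Qed.

Lemma hole_ideal_puncture : puncture_ideal I d hole_ideal.
Proof.
split; [|exact: hole_ideal_region|exact: hole_ideal_largest].
by exists hole; [move=> m /holeP[] | exact: hole_ideal_generated].
Qed.

(** By maximality any [J] in the definition of [puncture] and [hole_ideal] contain each other, so
    the minimal generators of [J] are the holes minimal for divisibility. *)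
Lemma punctureP (m : 'X_{1..3}) : reflect (puncture I d m) (maximal_hole m).
Proof.
apply: (iffP (maximal_holeP m)) => [[hm mm]|[J [Jb Jr Jl] [mJ mmin]]].
  exists hole_ideal; first exact: hole_ideal_puncture.
  split; first by apply/mem_hole_ideal; exists m => //; apply: lepm_refl.
  move=> m' le /mem_hole_ideal[m'' h'' le'']; apply/mnmP => i.
  have e := mm m'' h'' (lepm_trans le'' le); rewrite e in le''.
  by apply/eqP; rewrite eqn_leq (mnm_lepP le i) (mnm_lepP le'' i).
have [hb hr hl] := hole_ideal_puncture.
have JE : {subset J <= hole_ideal} := hole_ideal_largest Jb Jr.
have EJ : {subset hole_ideal <= J} := Jl _ hb hr.
have inJ m' : hole m' -> 'X_[m'] \in J.
  by move=> h; apply/EJ/mem_hole_ideal; exists m' => //; apply: lepm_refl.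
have /JE/mem_hole_ideal[m' hm' le] := mJ.
by split=> [|m'' h'' le'']; [rewrite -(mmin m' le (inJ _ hm'))|apply: mmin (inJ _ h'')].
Qed.

End Punctures.

(** * Comparison of two tilings *)

Section MatchingOfTiling.

Variables (K : fieldType) (I : {pred {mpoly K[3]}}) (d : nat).
Hypothesis Iup : forall m m' : 'X_{1..3}, (m <= m')%MM -> 'X_[m] \in I -> 'X_[m'] \in I.

Definition Bmon (x y z : nat) : bool := 'X_[mon x y z] \in I.

Lemma Bmon_up : upclosed Bmon.
Proof.
by move=> x y z x' y' z' hx hy hz; apply: Iup; rewrite mnm_le3 !monE hx hy hz.
Qed.

Definition crossing (pi : 'X_{1..3} -> 'X_{1..3}) (i : 'I_3) (x y z : nat) : bool :=
  let u := mon x y z in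
  [&& 0 < u i, (u - U_(i))%MM \in down I d & pi (u - U_(i))%MM == u].

Variable pi : 'X_{1..3} -> 'X_{1..3}.
Hypothesis hpi : lozenge_tiling I d pi.

Lemma crossing_sum_up x y z : x + y + z + 1 = d -> ~~ Bmon x y z ->
  crossing pi vx x y z + crossing pi vy x y z + crossing pi vz x y z = 1.
Proof.
have [_ pinj psur padj] := hpi; move=> hd hB.
have uU : mon x y z \in up I d by rewrite mem_up !monE hB hd eqxx.
have [n nD en] := psur _ uU.
have [i ei] : exists i : 'I_3, mon x y z = (n + U_(i))%MM.
  by have := padj n nD; rewrite en => /existsP[i /eqP]; exists i.
have crE j : crossing pi j x y z = (j == i).
  apply/and3P/eqP => [[h0 hD /eqP e]|->].
    have en' : (mon x y z - U_(j))%MM = n by apply: pinj => //; rewrite e en.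
    have e2 : (n + U_(j))%MM = (n + U_(i))%MM by rewrite -ei -en' mnm_subK.
    have := congr1 (fun k : 'X_{1..3} => k j) e2; rewrite !mnmDU eqxx.
    by case: (i =P j) => // _; clear; lia.
  by rewrite ei mnm_addK mnmDU eqxx addn1 nD en ei eqxx.
by rewrite !crE; move: i {ei crE}; apply: ord3_cases.
Qed.

Lemma crossing_sum_hole x y z : x + y + z + 1 = d -> Bmon x y z ->
  crossing pi vx x y z + crossing pi vy x y z + crossing pi vz x y z = 0.
Proof.
have [pU _ _ _] := hpi; move=> hd hB.
have crE j : crossing pi j x y z = false.
  apply/negbTE/negP => /and3P[_ /pU]; rewrite mem_up => /andP[h _] /eqP e.
  by move: h; rewrite e -[_ \in I]/(Bmon x y z) hB.
by rewrite !crE.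
Qed.

Lemma mon_DU x y z : [/\ (mon x y z + U_(vx))%MM = mon x.+1 y z,
  (mon x y z + U_(vy))%MM = mon x y.+1 z & (mon x y z + U_(vz))%MM = mon x y z.+1].
Proof. by split; apply: mnm3P; rewrite mnmDU !monE /= ?addn0 ?addn1. Qed.

Lemma crossing_sum_down x y z : x + y + z + 2 = d -> ~~ Bmon x y z ->
  crossing pi vx x.+1 y z + crossing pi vy x y.+1 z + crossing pi vz x y z.+1 = 1.
Proof.
have [_ _ _ padj] := hpi; move=> hd hB.
have nD : mon x y z \in down I d by rewrite mem_down !monE hB hd eqxx.
have [ex ey ez] := mon_DU x y z.
rewrite /crossing -ex -ey -ez !mnm_addK !mnmDU nD /= !addn1 /=.
have [i /eqP ->] := existsP (padj _ nD).
have crE j : (mon x y z + U_(i) == mon x y z + U_(j))%MM = (i == j).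
  apply/eqP/eqP => [e|-> //].
  have := congr1 (fun k : 'X_{1..3} => k j) e; rewrite !mnmDU eqxx.
  by case: (i =P j) => // _; clear; lia.
by rewrite !crE; move: i {crE}; apply: ord3_cases.
Qed.

Lemma tiling_matching :
  matching_at d Bmon (crossing pi vx) (crossing pi vy) (crossing pi vz).
Proof.
split; [exact: crossing_sum_up|exact: crossing_sum_hole|exact: crossing_sum_down| | |].
- by move=> y z; rewrite /crossing mon_x.
- by move=> x z; rewrite /crossing mon_y.
by move=> x y; rewrite /crossing mon_z.
Qed.

(** The right-hand side is the sum from which [hdiff] is formed, so the values for two tilings
    differ by [hdiff] at the exponents of [e]. *)
Lemma below_crossing e : e \in path_ends I d ->
  below I d pi e = \sum_(0 <= j < e vy) crossing pi vz (d - 1 - e vz - j) j (e vz).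
Proof.
rewrite mem_path_ends => /andP[/and3P[_ e0 _] /eqP hd].
transitivity (\sum_(0 <= j < e vy) \sum_(m <- down I d | zfix pi m)
    (m == mon (d - 1 - e vz - j) j (e vz).-1)).
  rewrite exchange_big /= /below big_seq_cond [RHS]big_seq_cond.
  apply: eq_bigr => m /andP[]; rewrite mem_down => /andP[_ /eqP hm] _.
  rewrite big_mkord; case: (boolP (_ && _)) => [/andP[/eqP ez ey]|nh].
    rewrite (bigD1 (Ordinal ey)) //= big1 ?addn0.
      rewrite (_ : _ == _ = true) //; apply/eqP; apply: mnm3P; rewrite monE //.
        by move: hm hd ez; clear; lia.
      by move: ez; clear; lia.
    move=> i /eqP ni; apply/eqP; rewrite eqb0; apply/eqP => em; apply: ni.
    by apply: val_inj; rewrite /= em mon_y.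
  rewrite big1 // => i _; apply/eqP; rewrite eqb0; apply: contra nh => /eqP ->.
  by rewrite !monE ltn_ord andbT; move: e0; clear; lia.
rewrite big_nat [RHS]big_nat; apply: eq_bigr => j /andP[_ hj].
set x := d - 1 - e vz - j; set m0 := mon x j (e vz).-1.
have e1 : (mon x j (e vz) - U_(vz))%MM = m0.
  by apply: mnm3P; rewrite mnmBU !monE /= ?subn0 ?subn1.
rewrite /crossing e1 mon_z e0 /=.
have em : (m0 + U_(vz))%MM = mon x j (e vz) by rewrite -e1 mnm_subK // mon_z.
rewrite -em -[pi m0 == _]/(zfix pi m0).
rewrite big_mkcond /=.
transitivity (\sum_(m <- down I d) (zfix pi m0 && (m == m0))).
  by apply: eq_bigr => m _; case: (m =P m0) => [->|_]; [case: ifP|case: ifP; rewrite andbF].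
case: (zfix pi m0); last by rewrite big1 ?andbF.
rewrite andbT -count_uniq_mem ?down_uniq // -sum1_count [RHS]big_mkcond.
by apply: eq_bigr => m _ /=; case: (m == m0).
Qed.

End MatchingOfTiling.

(** * The parity of the height difference at the path ends *)

Section Parity.

Variables (K : fieldType) (I : {pred {mpoly K[3]}}) (d : nat).
Hypothesis Iup : forall m m' : 'X_{1..3}, (m <= m')%MM -> 'X_[m] \in I -> 'X_[m'] \in I.
Variables pi1 pi2 : 'X_{1..3} -> 'X_{1..3}.
Hypotheses (h1 : lozenge_tiling I d pi1) (h2 : lozenge_tiling I d pi2).

Hypothesis hfloating : forall m q : 'X_{1..3},
  floating I d m -> puncture I d q -> q <> m -> in_shadow d m q ->
  ~~ odd (side_length d m).
Hypothesis hcovering : forall m1 m2 q : 'X_{1..3},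
  puncture I d m1 -> puncture I d m2 -> m1 <> m2 -> overlap d m1 m2 ->
  puncture I d q -> q <> m1 -> q <> m2 -> in_shadow d (mgcd m1 m2) q ->
  ~~ odd (side_length d (mgcd m1 m2)).

Let B := Bmon I.
Let M1 := tiling_matching h1.
Let M2 := tiling_matching h2.
Let hd := hdiff d (crossing I d pi1 vz) (crossing I d pi2 vz).

Lemma hole_B (m : 'X_{1..3}) x y z : hole I d m -> m vx <= x -> m vy <= y -> m vz <= z ->
  (x + y + z + 1 == d) || (x + y + z + 2 == d) -> B x y z.
Proof.
by move=> /holeP[_ h] hx hy hz hdd; apply: h; rewrite ?mnm_le3 ?mdeg3 !monE ?hx ?hy ?hz.
Qed.

Lemma hdiff_on_hole (m : 'X_{1..3}) y z : hole I d m -> m vy <= y -> m vz <= z ->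
  m vx + y + z <= d -> hd y z = hd (m vy) (m vz).
Proof.
move=> hm; apply: (hdiff_puncture (Bmon_up Iup) M1 M2) => x' y' z' hx hy hz e.
by apply: hole_B hm hx hy hz _; rewrite e eqxx.
Qed.

(** An lcm of degree at most [d] means a common lattice vertex, at which both constant values can be
    read. *)
Lemma hdiff_meet (m m' : 'X_{1..3}) : hole I d m -> hole I d m' ->
  overlap d m m' || touch d m m' -> hd (m vy) (m vz) = hd (m' vy) (m' vz).
Proof.
move=> hm hm'; rewrite /overlap /touch mdeg3 /mlcm !mnmE => h.
rewrite -(hdiff_on_hole hm (y := maxn (m vy) (m' vy)) (z := maxn (m vz) (m' vz))).
- by apply: hdiff_on_hole hm' _ _ _; rewrite ?leq_maxr //; move: h; clear; lia.
- exact: leq_maxl.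
- exact: leq_maxl.
by move: h; clear; lia.
Qed.

Lemma puncture_hole (m : 'X_{1..3}) : puncture I d m -> hole I d m.
Proof. by move/(punctureP d Iup)/maximal_holeP => -[]. Qed.

Lemma hdiff_non_floating (m : 'X_{1..3}) : non_floating I d m -> hd (m vy) (m vz) = 0%R.
Proof.
elim=> [{}m /puncture_hole hm [i ei]|{}m m' /puncture_hole hm hm' IH ht].
  have /holeP[md _] := hm; rewrite mdeg3 in md.
  move: i ei; apply: ord3_cases => e.
  - rewrite -(hdiff_on_hole hm (y := m vy) (z := d - m vy)) //.
    + by apply: (hdiff_x0 (Bmon_up Iup) M1 M2); move: md; clear; lia.
    + by move: md; clear; lia.
    by rewrite e; move: md; clear; lia.
  - by rewrite e /hd hdiff_y0.
  by rewrite e; exact: (hdiff_z0 M1 M2).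
rewrite -IH; apply: hdiff_meet => //; apply: puncture_hole.
by case: hm'.
Qed.

Lemma is_end_path_ends x y z : is_end d B x y z = (mon x y z \in path_ends I d).
Proof.
rewrite mem_path_ends !monE /is_end (_ : (mon x y z - U_(vz))%MM = mon x y z.-1).
  by rewrite andbC.
by apply: mnm3P; rewrite mnmBU !monE /= ?subn0 ?subn1.
Qed.

Lemma shadow_puncture (g : 'X_{1..3}) x y z : x < g vx -> y < g vy -> is_end d B x y z ->
  exists q, [/\ puncture I d q, in_shadow d g q, q vx < g vx & q vy < g vy].
Proof.
move=> hx hy /and4P[/eqP hdd hB _ _].
have hw : hole I d (mon x y z).
  by apply: (@hole_monomial _ _ _ Iup _ 1) => //; rewrite mdeg3 !monE.
have [q hq le] := hole_above hw; exists q.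
have := le; rewrite mnm_le3 !monE => /and3P[qx qy _].
split; rewrite ?(leq_ltn_trans qx) ?(leq_ltn_trans qy) //.
  exact/(punctureP d Iup).
exists (mon x y z); rewrite !monE; split => //.
by rewrite mem_cat mem_monomials // mdeg3 !monE hdd eqxx.
Qed.

Lemma no_end_or a b : (exists x y z, [/\ x < a, y < b & is_end d B x y z]) \/
  (forall x y z, x < a -> y < b -> ~~ is_end d B x y z).
Proof.
have [/hasP[e eE /andP[ex ey]]|/hasPn h] :=
    boolP (has (fun e : 'X_{1..3} => (e vx < a) && (e vy < b)) (path_ends I d)).
  by left; exists (e vx), (e vy), (e vz); rewrite is_end_path_ends monK.
right=> x y z hx hy; apply/negP; rewrite is_end_path_ends => /h.
by rewrite !monE hx hy.
Qed.

Let f (y z : nat) : bool := odd `|hd y z|%N.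

Lemma f_hdiff y z : f y z -> hd y z <> 0%R.
Proof. by rewrite /f => h e; rewrite e in h. Qed.

(** A non-zero value makes the puncture floating. Without a path end in the shadow the value would
    be 0 by [hdiff_shadow]; a path end there lies in another puncture, so [hfloating] applies. *)
Lemma puncture_side_even (m : 'X_{1..3}) : puncture I d m -> f (m vy) (m vz) ->
  ~~ odd (side_length d m).
Proof.
move=> pm /f_hdiff fm; have hm := puncture_hole pm.
have /holeP[md _] := hm; rewrite mdeg3 in md.
have fl : floating I d m by split => // /hdiff_non_floating.
have [[x [y [z [hx hy hE]]]]|nE] := no_end_or (m vx) (m vy).
  have [q [pq sq qx qy]] := shadow_puncture hx hy hE.
  by apply: (hfloating fl pq) => // e; rewrite e ltnn in qx.
case: fm; rewrite -(hdiff_on_hole hm (y := m vy) (z := d - m vx - m vy)) //.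
- by apply: (hdiff_shadow (Bmon_up Iup) M1 M2) => //; move: md; clear; lia.
- by move: md; clear; lia.
by move: md; clear; lia.
Qed.

Lemma puncture_cover_even (m1 m2 : 'X_{1..3}) : puncture I d m1 -> puncture I d m2 ->
  m1 <> m2 -> overlap d m1 m2 -> f (m1 vy) (m1 vz) ->
  ~~ odd (side_length d (mgcd m1 m2)).
Proof.
move=> p1 p2 ne ov /f_hdiff f1.
have hB m : puncture I d m -> forall x y z, m vx <= x -> m vy <= y -> m vz <= z ->
    x + y + z + 1 = d -> B x y z.
  by move=> /puncture_hole hm x y z hx hy hz e; apply: hole_B hm hx hy hz _; rewrite e eqxx.
have [[x [y [z [hx hy hE]]]]|nE] := no_end_or (mgcd m1 m2 vx) (mgcd m1 m2 vy).
  have [q [pq sq qx qy]] := shadow_puncture hx hy hE.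
  by apply: (hcovering p1 p2 ne ov pq _ _ sq) => e; move: qx; rewrite /mgcd e mnmE; clear; lia.
case: f1; apply: (hdiff_cover (Bmon_up Iup) M1 M2 _ (hB _ p1) (hB _ p2)).
  by move: ov; rewrite /overlap mdeg3 /mlcm !mnmE.
by move=> x y z hx hy; apply: nE; rewrite mnmE.
Qed.

Lemma hdiff_ends_even :
  ~~ odd (\sum_(t < d) \sum_(y < d) (is_end d B (d - 1 - t - y) y t && f y t)).
Proof.
pose P x y z := maximal_hole I d (mon x y z).
have PP a b c : P a b c -> puncture I d (mon a b c) by move/(punctureP d Iup).
apply: (@ends_even d B P).
- exact: Bmon_up.
- by move=> a b c /maximal_holeP[/holeP[]]; rewrite mdeg3 !monE.
- move=> a b c x y z /maximal_holeP[hm _] hx hy hz; apply: hole_B hm _ _ _; rewrite monE //.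
- move=> a b c hdd h.
  have hm : hole I d (mon a b c).
    apply/holeP; rewrite mdeg3 !monE; split => // w; rewrite mnm_le3 !monE mdeg3.
    by move=> /and3P[wx wy wz] hw; rewrite -(monK w); apply: h.
  have [q hq] := hole_above hm; rewrite mnm_le3 !monE => /and3P[qx qy qz].
  by exists (q vx), (q vy), (q vz); rewrite /P monK.
- move=> a b c a' b' c' /maximal_holeP[hm _] /maximal_holeP[_ mm] ha hb hc.
  have e : mon a b c = mon a' b' c' by apply: mm; rewrite // mnm_le3 !monE ha hb hc.
  split.
  + by have := congr1 (fun k : 'X_{1..3} => k vx) e; rewrite !monE.
  + by have := congr1 (fun k : 'X_{1..3} => k vy) e; rewrite !monE.
  by have := congr1 (fun k : 'X_{1..3} => k vz) e; rewrite !monE.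
- move=> a b c y z /maximal_holeP[hm _] hb hc hdd; rewrite /f.
  by have := @hdiff_on_hole _ y z hm; rewrite !monE => ->.
- move=> a b c /PP pm hf; have := puncture_side_even pm; rewrite !monE => /(_ hf).
  by rewrite /side_length mdeg3 !monE.
move=> a b c a' b' c' /PP p1 /PP p2 ne ov hf.
have := puncture_cover_even p1 p2; rewrite /side_length /overlap !mdeg3 /mlcm /mgcd !mnmE /=.
apply=> // e; apply: ne.
have := congr1 (fun k : 'X_{1..3} => k vx) e; rewrite !monE => ->.
have := congr1 (fun k : 'X_{1..3} => k vy) e; rewrite !monE => ->.
by have := congr1 (fun k : 'X_{1..3} => k vz) e; rewrite !monE => ->.
Qed.

Lemma sum_ends_even : ~~ odd (\sum_(e <- path_ends I d) f (e vy) (e vz)).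
Proof.
have <- : \sum_(t < d) \sum_(y < d) (is_end d B (d - 1 - t - y) y t && f y t)
    = \sum_(e <- path_ends I d) f (e vy) (e vz); last exact: hdiff_ends_even.
transitivity (\sum_(t < d) \sum_(y < d) \sum_(e <- path_ends I d)
    ((e vz == t) && ((e vy == y) && f y t))).
  apply: eq_bigr => t _; apply: eq_bigr => y _; rewrite is_end_path_ends.
  case: (f y t); last by rewrite andbF big1 // => e _; rewrite !andbF.
  rewrite andbT -count_uniq_mem ?path_ends_uniq // -sum1_count big_mkcond.
  rewrite big_seq [RHS]big_seq; apply: eq_bigr => e; rewrite mem_path_ends => /andP[_ /eqP hdd].
  rewrite andbT /=; case: (boolP (_ && _)) => [/andP[/eqP ez /eqP ey]|nh].
    rewrite (_ : _ == _ = true) //; apply/eqP; apply: mnm3P; rewrite monE //.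
    by rewrite -ez -ey; move: hdd; clear; lia.
  case: eqP => // ee; case/negP: nh; rewrite ee !monE !eqxx //.
apply: etrans (_ : _ = _) _; first by apply: eq_bigr => t _; apply: exchange_big.
rewrite exchange_big /= big_seq [RHS]big_seq; apply: eq_bigr => e eE.
have := eE; rewrite mem_path_ends => /andP[_ /eqP hdd].
have yd : e vy < d by move: hdd; clear; lia.
have zd : e vz < d by move: hdd; clear; lia.
rewrite (bigD1 (Ordinal zd)) //= [X in _ + X]big1 ?addn0; last first.
  move=> i ni; rewrite big1 // => j _; case: eqP => //= ez.
  by case/eqP: ni; apply: val_inj; rewrite /= -ez.
rewrite (bigD1 (Ordinal yd)) //= !eqxx big1 ?addn0 // => j nj.
by case: eqP => //= ey; case/eqP: nj; apply: val_inj; rewrite /= -ey.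
Qed.

(** Modulo 2 the sum of the two values of [below] at an end is their difference [hdiff]. *)
Lemma below_parity :
  odd (\sum_(e <- path_ends I d) below I d pi1 e)
  = odd (\sum_(e <- path_ends I d) below I d pi2 e).
Proof.
have E : odd (\sum_(e <- path_ends I d) (below I d pi1 e + below I d pi2 e)) = false.
  rewrite -(negbTE sum_ends_even) !(big_morph odd oddD (erefl : odd 0 = false)).
  rewrite big_seq [RHS]big_seq; apply: eq_bigr => e eE; rewrite /f /hd /hdiff.
  rewrite oddb /dflow sumrB !below_crossing // -!(big_morph Posz PoszD (erefl (Posz 0))).
  move: (\sum_(_ <= _ < _) _) (\sum_(_ <= _ < _) _) => u v.
  by clear; lia.
move: E; rewrite big_split oddD /=.
by case: (odd _); case: (odd _).
Qed.

End Parity.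

(** * Permanent, determinant and rank *)

Section Matrices.

Variables (K : fieldType) (I : {pred {mpoly K[3]}}) (d : nat).
Hypothesis bal : balanced I d.

Definition tiling_perm (s : 'S_(size (down I d))) : bool :=
  [forall i : 'I_(size (down I d)), adjacent (nth 0%MM (down I d) i) (nth 0%MM (up I d) (s i))].

Definition tiling_of_perm (s : 'S_(size (down I d))) (n : 'X_{1..3}) : 'X_{1..3} :=
  if insub (index n (down I d)) is Some i then nth 0%MM (up I d) (s i) else n.

Lemma tiling_of_permE s (i : 'I_(size (down I d))) :
  tiling_of_perm s (nth 0%MM (down I d) i) = nth 0%MM (up I d) (s i).
Proof.
by rewrite /tiling_of_perm index_uniq ?ltn_ord ?down_uniq // valK.
Qed.

Lemma down_nth n : n \in down I d ->
  exists i : 'I_(size (down I d)), n = nth 0%MM (down I d) i.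
Proof.
move=> nD; have h : index n (down I d) < size (down I d) by rewrite index_mem.
by exists (Ordinal h); rewrite /= nth_index.
Qed.

Lemma up_nth_inj (i j : 'I_(size (down I d))) :
  nth 0%MM (up I d) i = nth 0%MM (up I d) j -> i = j.
Proof.
move/eqP; rewrite nth_uniq ?up_uniq -?bal ?ltn_ord // => /eqP e.
exact: val_inj.
Qed.

Lemma tiling_of_permP s : tiling_perm s -> lozenge_tiling I d (tiling_of_perm s).
Proof.
move/forallP => hs; split.
- move=> _ /down_nth[i ->]; rewrite tiling_of_permE mem_nth //.
  by rewrite -bal ltn_ord.
- move=> _ _ /down_nth[i ->] /down_nth[j ->]; rewrite !tiling_of_permE.
  by move/up_nth_inj/perm_inj => ->.
- move=> u uU; have h : index u (up I d) < size (down I d) by rewrite bal index_mem.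
  exists (nth 0%MM (down I d) (s^-1%g (Ordinal h))); first by rewrite mem_nth.
  by rewrite tiling_of_permE permKV /= nth_index.
by move=> _ /down_nth[i ->]; rewrite tiling_of_permE.
Qed.

Lemma biadjacency_prod (R : comNzRingType) (s : 'S_(size (down I d))) :
  (\prod_i sq_biadjacency R bal i (s i) = (tiling_perm s)%:R)%R.
Proof.
have E i : sq_biadjacency R bal i (s i) =
    ((adjacent (nth 0%MM (down I d) i) (nth 0%MM (up I d) (s i)))%:R)%R.
  by rewrite castmxE !mxE.
have [/forallP h|/forallPn[i ni]] := boolP (tiling_perm s).
  by rewrite big1 // => i _; rewrite E h.
by rewrite (bigD1 i) //= E (negbTE ni) mul0r.
Qed.

Lemma permanent_biadjacency (R : comNzRingType) :
  permanent (sq_biadjacency R bal) = (#|tiling_perm|%:R)%R.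
Proof.
rewrite /permanent (eq_bigr _ (fun s _ => biadjacency_prod R s)) -sum1_card natr_sum.
rewrite [RHS]big_mkcond; apply: eq_bigr => s _.
by rewrite -[s \in _]/(tiling_perm s); case: (tiling_perm s).
Qed.

Hypothesis same_sign : forall pi1 pi2 : 'X_{1..3} -> 'X_{1..3},
  lozenge_tiling I d pi1 -> lozenge_tiling I d pi2 ->
  exists e : int, perfect_matching_sign I d pi1 e /\ perfect_matching_sign I d pi2 e.

Lemma tiling_perm_sign s t : tiling_perm s -> tiling_perm t ->
  odd_perm s = odd_perm t.
Proof.
move=> hs ht; have [e [[s' es' e1] [t' et' e2]]] :=
  same_sign (tiling_of_permP hs) (tiling_of_permP ht).
have -> : s = s' by apply/permP => i; apply: up_nth_inj; rewrite es' tiling_of_permE.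
have -> : t = t' by apply/permP => i; apply: up_nth_inj; rewrite et' tiling_of_permE.
by apply: (@signr_inj int); rewrite -e1.
Qed.

(** All non-zero terms of the determinant carry the same sign. It is chosen before the ring, so that
    one statement serves the integers and every field. *)
Lemma det_biadjacency : exists b : bool, forall R : comNzRingType,
  (\det (sq_biadjacency R bal) = (-1) ^+ b * permanent (sq_biadjacency R bal))%R.
Proof.
have [/existsP[s0 hs0]|/existsPn no] := boolP [exists s, tiling_perm s].
  exists (odd_perm s0) => R; rewrite /determinant /permanent mulr_sumr.
  apply: eq_bigr => s _; rewrite biadjacency_prod.
  by have [hs|_] := boolP (tiling_perm s); rewrite ?mulr0 // (tiling_perm_sign hs hs0).
exists false => R; rewrite mul1r; apply: eq_bigr => s _.
by rewrite biadjacency_prod (negbTE (no s)) mulr0.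
Qed.

Lemma tileable_perm : tileable I d <-> 0 < #|tiling_perm|.
Proof.
split=> [ht|/card_gt0P[s hs]]; last by right; exists (tiling_of_perm s); apply: tiling_of_permP.
apply/card_gt0P; case: ht => [[D0 _]|[pi hpi]].
  (* With no triangles the identity is vacuously a tiling permutation, so the count is positive for
     the empty region. *)
  exists 1%g; apply/forallP => -[i hi]; exfalso.
  by move: hi; rewrite {1}D0.
have [e [[s hs _] _]] := same_sign hpi hpi; have [_ _ _ padj] := hpi.
by exists s; apply/forallP => i; rewrite hs padj ?mem_nth.
Qed.

(** Up to sign the determinant is the number of tiling permutations, whose image in a field of
    characteristic zero vanishes only if the number does. *)
Lemma rank_biadjacency (L : fieldType) : [pchar L]%R =i pred0 ->
  \rank (biadjacency I d L) = minn (size (down I d)) (size (up I d)) <-> tileable I d.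
Proof.
move=> /pcharf0P L0; have [b /(_ L) hdet] := det_biadjacency.
have -> : minn (size (down I d)) (size (up I d)) = size (down I d).
  by rewrite -bal minnn.
have -> : \rank (biadjacency I d L) = \rank (sq_biadjacency L bal).
  have cast m n n' (e : n = n') (M : 'M[L]_(m, n)) :
      \rank M = \rank (castmx (erefl m, e) M) by case: n' / e; rewrite castmx_id.
  exact: cast.
apply: (iff_trans _ (iff_sym tileable_perm)).
have <- : (sq_biadjacency L bal \in unitmx) = (0 < #|tiling_perm|).
  rewrite unitmxE unitfE hdet permanent_biadjacency mulf_eq0 signr_eq0 /= L0.
  by rewrite -lt0n.
by rewrite -row_free_unit; split=> [/eqP|/eqP].
Qed.

End Matrices.

Local Open Scope ring_scope.

Theorem proposition6p15 (K : fieldType) (I : {pred {mpoly K[3]}}) (d : nat)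
  (hd : (0 < d)%N) (hI : monomial_ideal I) (bal : balanced I d)
  (hfloating : forall m q : 'X_{1..3},
     floating I d m -> puncture I d q -> q <> m -> in_shadow d m q ->
     ~~ odd (side_length d m))
  (hcovering : forall m1 m2 q : 'X_{1..3},
     puncture I d m1 -> puncture I d m2 -> m1 <> m2 -> overlap d m1 m2 ->
     puncture I d q -> q <> m1 -> q <> m2 -> in_shadow d (mgcd m1 m2) q ->
     ~~ odd (side_length d (mgcd m1 m2))) :
  [/\ forall pi1 pi2 : 'X_{1..3} -> 'X_{1..3},
        lozenge_tiling I d pi1 -> lozenge_tiling I d pi2 ->
        (exists e : int, perfect_matching_sign I d pi1 e /\
                         perfect_matching_sign I d pi2 e) /\
        (exists e : int, lattice_path_sign I d pi1 e /\
                         lattice_path_sign I d pi2 e),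
      permanent (sq_biadjacency int bal) = `|\det (sq_biadjacency int bal)|
    & forall F : fieldType, [pchar F] =i pred0 ->
        (\rank (biadjacency I d F) = minn (size (down I d)) (size (up I d))
         <-> tileable I d)].
Proof.
have [G gen] := hI.
have Iup (m m' : 'X_{1..3}) : (m <= m')%MM -> 'X_[m] \in I -> 'X_[m'] \in I.
  exact: generated_up gen m m'.
have signs pi1 pi2 : lozenge_tiling I d pi1 -> lozenge_tiling I d pi2 ->
    (exists e : int, perfect_matching_sign I d pi1 e /\ perfect_matching_sign I d pi2 e) /\
    (exists e : int, lattice_path_sign I d pi1 e /\ lattice_path_sign I d pi2 e).
  move=> h1 h2; have hb := below_parity Iup h1 h2 hfloating hcovering.
  split.
    have [s1 hs1 o1] := perfect_matching_perm Iup h1 (erefl _) (esym bal).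
    have [s2 hs2 o2] := perfect_matching_perm Iup h2 (erefl _) (esym bal).
    exists ((-1) ^+ s1)%R; split; first by exists s1.
    exists s2 => //; congr (_ ^+ nat_of_bool _)%R.
    by rewrite o1 o2 !oddD hb (sum_alive_eq h1 h2).
  have [s1 hs1 o1] := lattice_path_perm Iup h1.
  have [s2 hs2 o2] := lattice_path_perm Iup h2.
  have sz := size_path_starts Iup h1.
  exists ((-1) ^+ s1)%R; split; split => //; first by exists s1.
  exists s2 => //; congr (_ ^+ nat_of_bool _)%R; rewrite o1 o2.
  (* The sum of [above] and [below] does not depend on the tiling, so equal parities of [below] give
     equal parities of [above]. *)
  have : (\sum_(e <- path_ends I d) (above I d pi1 e + below I d pi1 e))%N
       = (\sum_(e <- path_ends I d) (above I d pi2 e + below I d pi2 e))%N.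
    by apply: eq_bigr => e _; rewrite !above_below.
  move/(congr1 odd); rewrite !big_split !oddD /= hb.
  exact: (@addIb (odd (\sum_(e <- path_ends I d) below I d pi2 e)%N)).
have same_sign pi1 pi2 h1 h2 := proj1 (signs pi1 pi2 h1 h2).
split; [exact: signs| |].
  have [b ->] := det_biadjacency bal same_sign.
  by rewrite normrM normr_sign mul1r permanent_biadjacency ger0_norm ?ler0n.
by move=> F; apply: rank_biadjacency.
Qed.
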